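(* Let $p\ne2,3$ be a prime and let $\mathsf v$ be the Ramanujan vector field $$\mathsf v=(t_1^2-\tfrac1{12}t_2)\frac{\partial}{\partial t_1}+(4t_1t_2-6t_3)\frac{\partial}{\partial t_2}+(6t_1t_3-\tfrac13t_2^2)\frac{\partial}{\partial t_3}.$$ The following are equivalent: 1. There is a curve $C$ in $\mathbb A^3_{\mathbb F_p}=\mathrm{Spec}\,\mathbb F_p[t_1,t_2,t_3]$ passing through $a:=(-\frac1{12},\frac1{12},-\frac1{216})$, smooth at $a$, tangent to the vector $b=(2,20,\frac73)$ at $a$, tangent to $\mathsf v$, and such that $\mathsf v^p=\mathsf v$ restricted to $C$. 2. The formal power series solution $t_i=\sum_{n\ge0}t_{i,n}q^n\in\mathbb Q[[q]]$, $i=1,2,3$, of the system $$-q\frac{\partial t_1}{\partial q}=t_1^2-\tfrac1{12}t_2,\quad -q\frac{\partial t_2}{\partial q}=4t_1t_2-6t_3,\quad -q\frac{\partial t_3}{\partial q}=6t_1t_3-\tfrac13t_2^2$$ with initial values $t_1=-\frac1{12}(1-24q+\cdots)$, i.e. $t_{1,0}=-\frac1{12}$, $t_{1,1}=2$, is $p$-integral, that is, $p$ does not appear in the denominator of any $t_{i,n}$.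
   Context: The formal solution in item 2 exists and all its coefficients $t_{i,n}\in\mathbb Q$ are determined recursively by the given initial values. For a curve $C$ with ideal $I\subset\mathbb F_p[t_1,t_2,t_3]$, ''$C$ is tangent to $\mathsf v$'' means $\mathsf v(I)\subset I$, where $\mathsf v$ is viewed as a derivation of $\mathbb F_p[t_1,t_2,t_3]$; $\mathsf v^p$ is the $p$-fold iterate of this derivation (again a derivation in characteristic $p$), and ''$\mathsf v^p=\mathsf v$ restricted to $C$'' means $\mathsf v^p(g)-\mathsf v(g)\in I$ for all $g\in\mathbb F_p[t_1,t_2,t_3]$. *)

(* Defs.v *)
From mathcomp Require Import all_boot all_order all_algebra.
From mathcomp.algebra Require Import ring_quotient.
From mathcomp Require Import mpoly.

Set Implicit Arguments.
Unset Strict Implicit.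
Unset Printing Implicit Defensive.

Import GRing.Theory.

Local Open Scope ring_scope.

(* Ideals are boolean predicates, as in ring_quotient; idealr_closed includes
   properness (1 is not in I), so the empty subscheme is excluded throughout. *)
Section Ideals.
Variable A : comNzRingType.
Implicit Types I P Q : {pred A}.

Definition prime_ideal P : Prop := idealr_closed P /\ prime_idealr_closed P.

Definition radical_ideal I : Prop :=
  idealr_closed I /\ forall (f : A) (n : nat), f ^+ n \in I -> f \in I.

Definition minimal_prime_over I P : Prop :=
  [/\ prime_ideal P, {subset I <= P} &
      forall Q, prime_ideal Q -> {subset I <= Q} -> {subset Q <= P} ->
        {subset P <= Q}].

(* Primes c 0 < c 1 < ... < c d containing I; the c i for i > d are irrelevant. *)
Definition prime_chain_over I (d : nat) (c : nat -> {pred A}) : Prop :=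
  [/\ forall i, (i <= d)%N -> prime_ideal (c i),
      {subset I <= c 0%N} &
      forall i, (i < d)%N ->
        {subset c i <= c i.+1} /\ ~ {subset c i.+1 <= c i}].

(* The Krull dimension of A / I is d; truncating a longer chain gives one of
   length d + 1, so it suffices to exclude the latter. *)
Definition krull_dim_quotient I (d : nat) : Prop :=
  (exists c, prime_chain_over I d c) /\
  ~ (exists c, prime_chain_over I d.+1 c).

End Ideals.

Section Curves.
Variables (F : fieldType) (n : nat).
Implicit Types (I : {pred {mpoly F[n]}}) (a w : 'rV[F]_n).

(* I is the ideal of a curve in affine n-space: a nonempty reduced closed
   subscheme all of whose irreducible components have dimension 1. *)
Definition curve_ideal I : Prop :=
  radical_ideal I /\
  forall P, minimal_prime_over I P -> krull_dim_quotient P 1.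

Definition passes_through I a : Prop :=
  forall f, f \in I -> f.@[fun i => a 0 i] = 0.

(* w lies in the Zariski tangent space at a of the zero scheme of I. *)
Definition tangent_vector I a w : Prop :=
  forall f, f \in I -> \sum_(i < n) w 0 i * (f^`M(i)).@[fun j => a 0 j] = 0.

(* Smoothness at a rational point a of a curve: the tangent space at a is a
   line, i.e. the Jacobian matrix at a has rank n - 1. *)
Definition curve_smooth_at I a : Prop :=
  exists2 T : {vspace 'rV[F]_n},
    forall w, w \in T <-> tangent_vector I a w & \dim T = 1%N.

(* The derivation \sum_i (v i) d/dt_i of F[t_1, ..., t_n]. *)
Definition derivation_of (v : 'I_n -> {mpoly F[n]}) (f : {mpoly F[n]}) :
    {mpoly F[n]} :=
  \sum_(i < n) v i * f^`M(i).

Definition tangent_to (D : {mpoly F[n]} -> {mpoly F[n]}) I : Prop :=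
  forall f, f \in I -> D f \in I.

Definition derivations_agree_on (D E : {mpoly F[n]} -> {mpoly F[n]}) I : Prop :=
  forall g, D g - E g \in I.

End Curves.

Definition row3 (F : fieldType) (x y z : F) : 'rV[F]_3 :=
  \row_(i < 3) [:: x; y; z]`_i.

(* The indices 0, 1, 2 stand for t_1, t_2, t_3. *)
Definition ramanujan_coef (F : fieldType) : 'I_3 -> {mpoly F[3]} :=
  let t1 : {mpoly F[3]} := 'X_(@Ordinal 3 0 isT) in
  let t2 : {mpoly F[3]} := 'X_(@Ordinal 3 1 isT) in
  let t3 : {mpoly F[3]} := 'X_(@Ordinal 3 2 isT) in
  fun i => [:: t1 ^+ 2 - 12^-1 *: t2;
               4 *: (t1 * t2) - 6 *: t3;
               6 *: (t1 * t3) - 3^-1 *: t2 ^+ 2]`_i.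

Definition ramanujan_vf (F : fieldType) : {mpoly F[3]} -> {mpoly F[3]} :=
  derivation_of (@ramanujan_coef F).

(* u : nat -> rat is the formal power series \sum_n (u n) q^n. *)
Definition fps_mul (u v : nat -> rat) : nat -> rat :=
  fun n => \sum_(k < n.+1) u k * v (n - k)%N.

(* q d/dq *)
Definition fps_theta (u : nat -> rat) : nat -> rat := fun n => n%:R * u n.

Definition ramanujan_solution (t1 t2 t3 : nat -> rat) : Prop :=
  [/\ forall n, - fps_theta t1 n = fps_mul t1 t1 n - 12^-1 * t2 n,
      forall n, - fps_theta t2 n = 4 * fps_mul t1 t2 n - 6 * t3 n,
      forall n, - fps_theta t3 n = 6 * fps_mul t1 t3 n - 3^-1 * fps_mul t2 t2 n,
      t1 0%N = - 12^-1 &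
      t1 1%N = 2].

Definition p_integral (p : nat) (x : rat) : Prop := ~~ (p %| `|denq x|)%N.

Definition fps_p_integral (p : nat) (u : nat -> rat) : Prop :=
  forall n, p_integral p (u n).

Definition curve_condition (p : nat) : Prop :=
  let a : 'rV['F_p]_3 := row3 (- 12^-1) 12^-1 (- 216^-1) in
  let b : 'rV['F_p]_3 := row3 2 20 (7 / 3) in
  let v := @ramanujan_vf 'F_p in
  exists I : {pred {mpoly 'F_p[3]}},
    [/\ curve_ideal I,
        passes_through I a /\ curve_smooth_at I a,
        tangent_vector I a b,
        tangent_to v I &
        derivations_agree_on (iter p v) v I].

(* "The" solution: the unique triple solving the initial value problem. *)
Definition integrality_condition (p : nat) : Prop :=
  exists t1 t2 t3 : nat -> rat,
    [/\ ramanujan_solution t1 t2 t3,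
        forall u1 u2 u3, ramanujan_solution u1 u2 u3 ->
          [/\ u1 =1 t1, u2 =1 t2 & u3 =1 t3] &
        [/\ fps_p_integral p t1, fps_p_integral p t2 & fps_p_integral p t3]].

(* Main.v *)
From HB Require Import structures.
Require Import Defs.
From mathcomp Require Import all_boot all_order all_algebra.
From mathcomp Require Import mpoly.
From mathcomp Require Import ring lra zify.
From mathcomp Require boolp.

Set Implicit Arguments.
Unset Strict Implicit.
Unset Printing Implicit Defensive.

Import Order.TTheory GRing.Theory Num.Theory.

(** The equivalence holds because both conditions hold for every prime p > 3.

    Integrality. The solution is t_1 = - E_2 / 12, t_2 = E_4 / 12,
    t_3 = - E_6 / 216 with the Eisenstein series E_2, E_4, E_6, whose
    coefficients are integers. That these satisfy the system is the content of
    Ramanujan's identities, equivalent to three convolution identities for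
    divisor sums ([divisor_conv11], [divisor_conv13], [divisor_conv15_33]).
    They follow from a count of the solutions of a x + b y = n in positive
    integers: one step of Euclid's algorithm matches the solutions with x > y
    with those with a < b ([lattice_sum_euclid]), and polynomials in a, b that
    are invariant under a rotation of order 6 turn this matching into identities
    between convolutions. The solution is unique because the linear part M of
    the system satisfies det (M + n) = n^2 (n - 1).

    The curve. Its ideal I is the kernel of the substitution of the q-expansions
    F_p[t_1, t_2, t_3] -> F_p[[q]]. It is prime since F_p[[q]] is a domain. The
    field v corresponds to - q d/dq, so that v (I) is contained in I, and
    v^p = v modulo I since (- n)^p = - n in F_p. The point a and the vector b are
    read off from the coefficients of q^0 and q^1. It remains to see that the
    curve has dimension 1 and is smooth at a, for which two independent
    relations between E_2, E_4, E_6 modulo p are needed. Classically these are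
    E_(p-1) = 1 and E_(p+1) = E_2 modulo p; here they come from the equality of
    D^p and D on F_p[[q]], where D = 12 q d/dq. For a modular form g of weight k
    the expansion of D^n g in powers of E_2 has the coefficients
    C(n, j) (k + n - 1) ... (k + n - j) times modular forms
    ([iter_derive_eval]), so that D^p g is a polynomial in E_4 and E_6 alone
    ([iter_prime_derive_eval]). On the cuspidal curve E_4^3 = E_6^2 this
    polynomial is a multiple of a product of p consecutive integers, hence it is
    divisible by E_4^3 - E_6^2 ([disc_dvd_serre_iter]). Solving D^p E_4 = D E_4
    and D^p E_6 = D E_6 linearly therefore gives polynomials alpha, beta with
    alpha (E_4, E_6) = 1 and beta (E_4, E_6) = E_2, where alpha is homogeneous
    of weight - 2 modulo p ([exists_hasse]).

    By Euler's identity the differential of alpha at a does not vanish; together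
    with that of beta - E_2 it shows that the tangent space is a line
    ([curve_smooth]). For the dimension, let P be a prime that strictly contains
    I. Elimination with the relation alpha = 1 shows that E_4 and E_6, hence also
    E_2 = beta, are algebraic over F_p modulo P ([prime_elimination]); so a power
    of Frobenius is the identity modulo P, and P is maximal
    ([curve_prime_maximal]). *)
(** * Formal power series *)

Definition fps (R : comNzRingType) : Type := nat -> R.

(** Equality of two sequences of coefficients is decided classically. *)
HB.instance Definition _ (R : comNzRingType) := boolp.gen_eqMixin (fps R).
HB.instance Definition _ (R : comNzRingType) := boolp.gen_choiceMixin (fps R).

Section FormalPowerSeries.
Local Open Scope ring_scope.
Variable R : comNzRingType.
Implicit Types u v w : fps R.

Definition fps_zero : fps R := fun=> 0.
Definition fps_opp u : fps R := fun n => - u n.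
Definition fps_add u v : fps R := fun n => u n + v n.
Definition fps_const (c : R) : fps R := fun n => if n == 0 then c else 0.
Definition fps_conv u v : fps R := fun n => \sum_(k < n.+1) u k * v (n - k)%N.

Lemma fps_addA : associative fps_add.
Proof. by move=> u v w; apply: boolp.funext => n; rewrite /fps_add addrA. Qed.

Lemma fps_addC : commutative fps_add.
Proof. by move=> u v; apply: boolp.funext => n; rewrite /fps_add addrC. Qed.

Lemma fps_add0 : left_id fps_zero fps_add.
Proof. by move=> u; apply: boolp.funext => n; rewrite /fps_add add0r. Qed.

Lemma fps_addN : left_inverse fps_zero fps_opp fps_add.
Proof. by move=> u; apply: boolp.funext => n; rewrite /fps_add addNr. Qed.

HB.instance Definition _ :=
  GRing.isZmodule.Build (fps R) fps_addA fps_addC fps_add0 fps_addN.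

(** The ring axioms of power series are inherited from polynomials, because
    the coefficient of index n of a product only sees truncations. *)
Definition fps_trunc u (n : nat) : {poly R} := \poly_(k < n.+1) u k.

Lemma coef_fps_trunc u n k : (k <= n)%N -> (fps_trunc u n)`_k = u k.
Proof. by move=> le_kn; rewrite coef_poly ltnS le_kn. Qed.

Lemma fps_conv_trunc u v n k : (k <= n)%N ->
  fps_conv u v k = (fps_trunc u n * fps_trunc v n)`_k.
Proof.
move=> le_kn; rewrite coefM; apply: eq_bigr => i _.
by rewrite !coef_fps_trunc // (leq_trans _ le_kn) ?leq_subr // -ltnS.
Qed.

Lemma fps_convA : associative fps_conv.
Proof.
move=> u v w; apply: boolp.funext => n.
transitivity (fps_trunc u n * (fps_trunc v n * fps_trunc w n))`_n.
  rewrite [RHS]coefM; apply: eq_bigr => i _.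
  have le_in : (i <= n)%N by rewrite -ltnS.
  by rewrite -fps_conv_trunc ?leq_subr // coef_fps_trunc.
rewrite mulrA coefM; apply: eq_bigr => i _.
have le_in : (i <= n)%N by rewrite -ltnS.
by rewrite -fps_conv_trunc // coef_fps_trunc // leq_subr.
Qed.

Lemma fps_convC : commutative fps_conv.
Proof.
move=> u v; apply: boolp.funext => n.
by rewrite !(@fps_conv_trunc _ _ n) // mulrC.
Qed.

Lemma fps_conv1 : left_id (fps_const 1) fps_conv.
Proof.
move=> u; apply: boolp.funext => n.
rewrite /fps_conv big_ord_recl /= mul1r subn0 big1 ?addr0 // => i _.
by rewrite mul0r.
Qed.

Lemma fps_convDl : left_distributive fps_conv +%R.
Proof.
move=> u v w; apply: boolp.funext => n.
rewrite -[RHS]/(fps_conv u w n + fps_conv v w n) /fps_conv -big_split /=.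
by apply: eq_bigr => i _; rewrite mulrDl.
Qed.

Lemma fps_const1_neq0 : fps_const 1 != 0.
Proof.
by apply/eqP => /(congr1 (fun u : fps R => u 0)) /eqP; rewrite oner_eq0.
Qed.

HB.instance Definition _ := GRing.Zmodule_isComNzRing.Build (fps R)
  fps_convA fps_convC fps_conv1 fps_convDl fps_const1_neq0.

Lemma fps0E n : (0 : fps R) n = 0. Proof. by []. Qed.
Lemma fpsDE u v n : (u + v) n = u n + v n. Proof. by []. Qed.
Lemma fpsNE u n : (- u) n = - u n. Proof. by []. Qed.
Lemma fpsME u v n : (u * v) n = \sum_(k < n.+1) u k * v (n - k)%N.
Proof. by []. Qed.

Lemma fpsP u v : (forall n, u n = v n) -> u = v.
Proof. exact: boolp.funext. Qed.

Lemma fps_const_is_zmod_morphism : zmod_morphism fps_const.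
Proof. by move=> c d; apply: fpsP => -[|n] //; rewrite fpsDE fpsNE subr0. Qed.

HB.instance Definition _ :=
  GRing.isZmodMorphism.Build R (fps R) fps_const fps_const_is_zmod_morphism.

Lemma fps_constM c u n : (fps_const c * u) n = c * u n.
Proof.
rewrite fpsME big_ord_recl /= subn0 big1 ?addr0 // => i _.
by rewrite mul0r.
Qed.

Lemma fps_const_is_monoid_morphism : monoid_morphism fps_const.
Proof.
split=> // c d; apply: fpsP => n; rewrite fps_constM.
by case: n => //= n; rewrite mulr0.
Qed.

HB.instance Definition _ :=
  GRing.isMonoidMorphism.Build R (fps R) fps_const fps_const_is_monoid_morphism.

Lemma fps1E n : (1 : fps R) n = if n == 0 then 1 else 0. Proof. by []. Qed.

Lemma fps_natM m u n : (m%:R * u) n = m%:R * u n.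
Proof. by rewrite -(rmorph_nat fps_const) fps_constM. Qed.

Lemma fpsM_coef0 u v : (u * v) 0%N = u 0%N * v 0%N.
Proof. by rewrite fpsME big_ord1. Qed.

Lemma fpsM_coef1 u v : (u * v) 1%N = u 0%N * v 1%N + u 1%N * v 0%N.
Proof. by rewrite fpsME big_ord_recl big_ord1. Qed.

Definition theta u : fps R := fun n => n%:R * u n.

Lemma theta_is_zmod_morphism : zmod_morphism theta.
Proof. by move=> u v; apply: fpsP => n; rewrite /theta fpsDE mulrDr mulrN. Qed.

HB.instance Definition _ :=
  GRing.isZmodMorphism.Build (fps R) (fps R) theta theta_is_zmod_morphism.

Lemma thetaM u v : theta (u * v) = theta u * v + u * theta v.
Proof.
apply: fpsP => n; rewrite /theta fpsDE !fpsME mulr_sumr -big_split /=.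
apply: eq_bigr => i _; rewrite -[in n%:R](subnK (ltn_ord i : i <= n)%N).
by rewrite natrD; ring.
Qed.

Lemma theta_const c : theta (fps_const c) = 0.
Proof. by apply: fpsP => -[|n]; rewrite /theta ?mul0r //= mulr0. Qed.

Lemma theta_natM m u : theta (m%:R * u) = m%:R * theta u.
Proof. by rewrite !mulr_natl raddfMn. Qed.

End FormalPowerSeries.

Section MapPowerSeries.
Local Open Scope ring_scope.
Variables (R S : comNzRingType) (f : {rmorphism R -> S}).

Definition map_fps (u : fps R) : fps S := fun n => f (u n).

Lemma map_fps_is_zmod_morphism : zmod_morphism map_fps.
Proof. by move=> u v; apply: fpsP => n; rewrite /map_fps fpsDE rmorphB. Qed.

HB.instance Definition _ :=
  GRing.isZmodMorphism.Build (fps R) (fps S) map_fps map_fps_is_zmod_morphism.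

Lemma map_fps_is_monoid_morphism : monoid_morphism map_fps.
Proof.
split=> [|u v]; apply: fpsP => n; last first.
  rewrite /map_fps !fpsME rmorph_sum /=.
  by apply: eq_bigr => i _; rewrite rmorphM.
by case: n => [|n]; [apply: rmorph1 | apply: rmorph0].
Qed.

HB.instance Definition _ :=
  GRing.isMonoidMorphism.Build (fps R) (fps S) map_fps map_fps_is_monoid_morphism.

Lemma map_fps_theta u : map_fps (theta u) = theta (map_fps u).
Proof. by apply: fpsP => n; rewrite /map_fps /theta rmorphM rmorph_nat. Qed.

End MapPowerSeries.

Lemma fps_mul_eq0 (R : idomainType) (u v : fps R) :
  (u * v = 0 -> u = 0 \/ v = 0)%R.
Proof.
move=> uv0; apply: boolp.contrapT => /boolp.not_orP[u_neq0 v_neq0].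
have order (w : fps R) : (w <> 0)%R ->
    exists2 m, (w m != 0)%R & forall i, i < m -> (w i = 0)%R.
  move=> w_neq0; have ex_m : exists m, (w m != 0)%R.
    apply: boolp.contrapT => no_m; apply: w_neq0; apply: fpsP => n.
    by apply/eqP/negPn/negP => wn; apply: no_m; exists n.
  case: (ex_minnP ex_m) => m wm min_m; exists m => // i lt_im.
  by apply/eqP/negPn/negP => /min_m; rewrite leqNgt lt_im.
have [m um u_lt] := order u u_neq0; have [n vn v_lt] := order v v_neq0.
have /eqP : ((u * v)%R (m + n)%N = 0)%R by rewrite uv0.
have lt_m : m < (m + n).+1 by rewrite ltnS leq_addr.
rewrite fpsME (bigD1 (Ordinal lt_m)) //= addKn big1 ?addr0.
  by rewrite mulf_eq0 (negPf um) (negPf vn).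
move=> i; rewrite -val_eqE /= => neq_im; case: (ltnP i m) => [lt_im | le_mi].
  by rewrite u_lt ?mul0r.
rewrite v_lt ?mulr0 //; have := ltn_ord i; lia.
Qed.

Lemma fps_mulfI (R : idomainType) (u v w : fps R) :
  (u <> 0 -> u * v = u * w -> v = w)%R.
Proof.
move=> u_neq0 /eqP; rewrite -subr_eq0 -mulrBr => /eqP.
by case/fps_mul_eq0 => // /eqP; rewrite subr_eq0 => /eqP.
Qed.

(** * Convolution identities for divisor sums *)

(** The maps need to be inverse to each other between P and Q only, as befits
    maps between tuples of ordinals whose values are truncated elsewhere. *)
Lemma reindex_bij_on (R : Type) (idx : R) (op : Monoid.com_law idx)
    (I J : finType) (P : pred I) (Q : pred J) (h : J -> I) (h' : I -> J)
    (F : I -> R) :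
    (forall i, P i -> Q (h' i) /\ h (h' i) = i) ->
    (forall j, Q j -> P (h j) /\ h' (h j) = j) ->
  \big[op/idx]_(i | P i) F i = \big[op/idx]_(j | Q j) F (h j).
Proof.
move=> hP hQ; rewrite (reindex_onto h h') => [|i /hP[]//].
apply: eq_bigl => j; apply/andP/idP => [[/hP[Qj _] /eqP <-] // | /hQ[-> ->]].
by rewrite eqxx.
Qed.

Section DivisorSums.
Local Open Scope ring_scope.

Definition divisor_power_sum (r : nat) : fps int :=
  fun n => \sum_(1 <= d < n.+1 | (d %| n)%N) d%:Z ^+ r.

Section LatticeSum.
Variable n : nat.
Let I := 'I_n.+1.
Implicit Types (q : (I * I) * (I * I)) (g : int -> int -> int).

(** An index ((a, x), (b, y)) stands for a solution of a x + b y = n in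
    positive integers. *)
Definition solution q : bool :=
  let: ((a, x), (b, y)) := q in
  [&& 0 < a, 0 < x, 0 < b, 0 < y & a * x + b * y == n]%N.

Definition lattice_sum (g : int -> int -> int) : int :=
  \sum_(q | solution q) g q.1.1 q.2.1.

Lemma divisor_sum_pairs k (F : nat -> int) : (k <= n)%N ->
  \sum_(s : I * I | [&& 0 < s.1, 0 < s.2 & s.1 * s.2 == k]%N) F s.1 =
  \sum_(1 <= d < k.+1 | (d %| k)%N) F d.
Proof.
move=> le_kn; case: (posnP k) => [-> | k_gt0].
  rewrite big_geq // big_pred0 // => -[[a ?] [x ?]] /=.
  by apply/negP => /and3P[a0 x0]; rewrite muln_eq0 !eqn0Ngt a0 x0.
have ltd d : (d %| k)%N -> (d < n.+1)%N.
  by move=> dk; rewrite ltnS (leq_trans _ le_kn) // dvdn_leq.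
rewrite (reindex_onto (fun d : I => (d, inord (k %/ d) : I)) fst) /=; last first.
  move=> [a x] /= /and3P[a0 x0 /eqP axk]; congr pair; apply: val_inj => /=.
  by rewrite -axk mulKn ?inordK.
rewrite (big_nat_widen _ _ n.+1) ?ltnS // big_geq_mkord; apply: eq_bigl => d.
rewrite eqxx andbT; have lt_kd : (k %/ d < n.+1)%N.
  by rewrite ltnS (leq_trans (leq_div _ _)).
rewrite inordK //; rewrite [RHS]andbC; case: (posnP d) => //= d0.
rewrite ltnS; apply/andP/andP => [[kd0 /eqP dk] | [dk _]].
  have := leq_pmulr d kd0; rewrite dk => ->; split=> //.
  by rewrite -dk dvdn_mulr.
by rewrite divn_gt0 // mulnC divnK // eqxx dvdn_leq.
Qed.

Lemma lattice_sum_split (P : pred ((I * I) * (I * I))) g :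
  lattice_sum g = \sum_(q | solution q && P q) g q.1.1 q.2.1 +
                  \sum_(q | solution q && ~~ P q) g q.1.1 q.2.1.
Proof. exact: bigID. Qed.

Lemma lattice_sum_shift g :
  \sum_(q | solution q && (q.2.2 < q.1.2)%N) g q.1.1 q.2.1 =
  \sum_(q | solution q && (q.1.1 < q.2.1)%N) g q.1.1 (q.2.1%:Z - q.1.1%:Z).
Proof.
rewrite (@reindex_bij_on _ _ _ _ _ _
  (fun q => solution q && (q.1.1 < q.2.1)%N)
  (fun q => ((q.1.1, inord (q.1.2 + q.2.2)), (inord (q.2.1 - q.1.1), q.2.2)))
  (fun q => ((q.1.1, inord (q.1.2 - q.2.2)), (inord (q.1.1 + q.2.1), q.2.2)))).
- apply: eq_bigr => -[[a x] [b y]] /= /andP[_ lt_ab].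
  by rewrite subzn 1?ltnW // inordK // (leq_ltn_trans (leq_subr _ _)).
- move=> [[a x] [b y]] /= /andP[/and5P[a0 x0 b0 y0 /eqP axby] lt_yx].
  have Exy : (inord (x - y) : I) = (x - y)%N :> nat.
    by rewrite inordK // (leq_ltn_trans (leq_subr _ _)).
  have Eab : (inord (a + b) : I) = (a + b)%N :> nat by rewrite inordK //; nia.
  split; last by congr (_, _, (_, _)); apply: val_inj => /=;
    rewrite inordK ?Exy ?Eab ?subnK ?addKn // ltnW.
  by rewrite Exy Eab; apply/andP; split; [apply/and5P; split|] => //; nia.
- move=> [[a x] [b y]] /= /andP[/and5P[a0 x0 b0 y0 /eqP axby] lt_ab].
  have Eba : (inord (b - a) : I) = (b - a)%N :> nat.
    by rewrite inordK // (leq_ltn_trans (leq_subr _ _)).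
  have Exy : (inord (x + y) : I) = (x + y)%N :> nat by rewrite inordK //; nia.
  split; last by congr (_, _, (_, _)); apply: val_inj => /=;
    rewrite inordK ?Exy ?Eba ?addnK ?subnKC // ltnW.
  by rewrite Exy Eba; apply/andP; split; [apply/and5P; split|] => //; nia.
Qed.

Lemma lattice_sum_swap (P : pred ((I * I) * (I * I))) g :
  \sum_(q | solution q && P q) g q.1.1 q.2.1 =
  \sum_(q | solution q && P (q.2, q.1)) g q.2.1 q.1.1.
Proof.
apply: (@reindex_bij_on _ _ _ _ _ _ _ (fun q => (q.2, q.1)) (fun q => (q.2, q.1)));
  by move=> [[a x] [b y]] /= /andP[/and5P[-> -> -> -> /eqP axby] ->];
     rewrite addnC axby eqxx.
Qed.

Lemma lattice_sum_diag_right g :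
  \sum_(q | solution q && (q.1.2 == q.2.2)) g q.1.1 q.2.1 =
  \sum_(1 <= d < n.+1 | (d %| n)%N)
    \sum_(u < d | (0 < u)%N) g u (d%:Z - u%:Z).
Proof.
rewrite big_geq_mkord /=.
transitivity (\sum_(d : I | (d %| n)%N && (0 < d)%N)
  \sum_(u : I | (0 < u < d)%N) g u (d%:Z - u%:Z)); last first.
  apply: eq_bigr => d _; have := ltn_ord d; rewrite ltnS => le_dn.
  rewrite [RHS](big_ord_widen_cond n.+1 (fun u => 0 < u)%N
                 (fun u => g u (d%:Z - u%:Z))) //.
  exact: leqW.
rewrite pair_big_dep /=.
rewrite (@reindex_bij_on _ _ _ _ _ _
  (fun s : I * I => ((s.1 %| n) && (0 < s.1) && (0 < s.2 < s.1))%N)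
  (fun s => ((s.2, inord (n %/ s.1)), (inord (s.1 - s.2), inord (n %/ s.1))))
  (fun q => (inord (q.1.1 + q.2.1), q.1.1))).
- apply: eq_bigr => -[d u] /= /andP[_ /andP[_ lt_ud]].
  by rewrite subzn 1?ltnW // inordK // (leq_ltn_trans (leq_subr _ _)).
- move=> [[a x] [b y]] /= /andP[/and5P[a0 x0 b0 y0 /eqP axby] /eqP exy].
  rewrite -{y}exy in y0 axby *.
  have Eab : (inord (a + b) : I) = (a + b)%N :> nat by rewrite inordK //; nia.
  have nE : (x * (a + b))%N = n by lia.
  have Ex : (n %/ (a + b))%N = x.
    by rewrite -[X in (X %/ _)%N]nE mulnK // addn_gt0 a0.
  rewrite Eab Ex inord_val; split.
    rewrite -[X in (_ %| X)%N]nE dvdn_mull // addn_gt0 a0 /=.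
    by rewrite -[X in (X < _)%N]addn0 ltn_add2l.
  by congr (_, _, (_, _)); apply: val_inj; rewrite /= inordK // addKn.
- move=> [d u] /= /andP[/andP[dn d0] /andP[u0 lt_ud]].
  have Edu : (inord (d - u) : I) = (d - u)%N :> nat.
    by rewrite inordK // (leq_ltn_trans (leq_subr _ _)).
  have End : (inord (n %/ d) : I) = (n %/ d)%N :> nat.
    by rewrite inordK // ltnS leq_div.
  have nd0 : (0 < n %/ d)%N.
    by rewrite divn_gt0 // -ltnS.
  split; last first.
    by congr (_, _); apply: val_inj; rewrite /= inordK ?Edu ?subnKC // ltnW.
  rewrite Edu End eqxx u0 nd0 subn_gt0 lt_ud /= -mulnDl subnKC 1?ltnW //.
  by rewrite mulnC divnK // eqxx.
Qed.

Lemma lattice_sum_diag_left g :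
  \sum_(q | solution q && (q.2.1 == q.1.1)) g q.1.1 q.2.1 =
  \sum_(1 <= d < n.+1 | (d %| n)%N) ((n %/ d)%:Z - 1) * g d d.
Proof.
rewrite big_geq_mkord /=.
transitivity (\sum_(d : I | (d %| n)%N && (0 < d)%N)
  \sum_(u : I | (0 < u < n %/ d)%N) g d d); last first.
  apply: eq_bigr => d /andP[dn d0].
  rewrite sumr_const -mulr_natl; congr (_ * _).
  have nd0 : (0 < n %/ d)%N by rewrite divn_gt0 // -ltnS.
  rewrite -sum1_card big_mkcond /=.
  rewrite -(big_mkcond (fun u : I => 0 < u < n %/ d)%N) /=.
  rewrite -(big_ord_widen_cond n.+1 (fun u => 0 < u)%N (fun=> 1%N)); last first.
    by rewrite leqW // leq_div.
  rewrite -(big_geq_mkord 1 _ predT (fun=> 1%N)) sum_nat_const_nat muln1.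
  by rewrite natrB // natz.
rewrite pair_big_dep /=.
rewrite (@reindex_bij_on _ _ _ _ _ _
  (fun s : I * I => ((s.1 %| n) && (0 < s.1) && (0 < s.2 < n %/ s.1))%N)
  (fun s => ((s.1, s.2), (s.1, inord (n %/ s.1 - s.2))))
  (fun q => (q.1.1, q.1.2))) //=.
- move=> [[a x] [b y]] /= /andP[/and5P[a0 x0 b0 y0 /eqP axby] /eqP eab].
  rewrite {b}eab in b0 axby *.
  have nE : ((x + y) * a)%N = n by lia.
  have Exy : (n %/ a)%N = (x + y)%N by rewrite -[X in (X %/ _)%N]nE mulnK.
  rewrite Exy addKn inord_val a0 x0 -[X in (_ %| X)%N]nE dvdn_mull //=.
  by split=> //; rewrite -[X in (X < _)%N]addn0 ltn_add2l.
- move=> [d u] /= /andP[/andP[dn d0] /andP[u0 lt_ud]]; split=> //.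
  rewrite eqxx d0 u0 inordK; last first.
    by rewrite ltnS (leq_trans (leq_subr _ _)) // leq_div.
  by rewrite subn_gt0 lt_ud -mulnDr subnKC 1?ltnW // mulnC divnK // eqxx.
Qed.

(** Subtracting the smaller of a, b from the larger one, as in Euclid's
    algorithm, matches the solutions with x > y with those with a < b; only
    the diagonals x = y and a = b are left over. *)
Lemma lattice_sum_euclid (g G : int -> int -> int) :
    (forall u v, g u (v - u) = G u v) -> (forall u v, g (u - v) v = G u v) ->
  lattice_sum g - lattice_sum G =
  \sum_(1 <= d < n.+1 | (d %| n)%N)
    (\sum_(u < d) g u (d%:Z - u%:Z) - (n %/ d)%:Z * G d d).
Proof.
move=> gG1 gG2.
have split3 (f1 f2 : ((I * I) * (I * I)) -> I) h : lattice_sum h =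
    \sum_(q | solution q && (f1 q < f2 q)%N) h q.1.1 q.2.1 +
    \sum_(q | solution q && (f2 q < f1 q)%N) h q.1.1 q.2.1 +
    \sum_(q | solution q && (f1 q == f2 q)) h q.1.1 q.2.1.
  rewrite (lattice_sum_split (fun q => f1 q == f2 q)) addrC; congr (_ + _).
  rewrite (bigID (fun q => f1 q < f2 q)%N) /=.
  by congr (_ + _); apply: eq_bigl => q; rewrite -andbA -val_eqE;
    case: (ltngtP (f1 q) (f2 q)).
rewrite (split3 (fun q => q.1.2) (fun q => q.2.2)).
rewrite (split3 (fun q => q.2.1) (fun q => q.1.1) G).
rewrite lattice_sum_shift (lattice_sum_swap (fun q => q.1.2 < q.2.2)%N) /=.
rewrite (@lattice_sum_shift (fun u v => g v u)).
rewrite [in X in _ - X](lattice_sum_swap (fun q => q.2.1 < q.1.1)%N) /=.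
under eq_bigr do rewrite gG2.
under [X in _ + X + _ - _]eq_bigr do rewrite gG1.
rewrite lattice_sum_diag_left lattice_sum_diag_right opprD addrACA subrr add0r.
rewrite -sumrB.
rewrite [LHS]big_geq_mkord [RHS]big_geq_mkord.
apply: eq_bigr => -[d /= _] /andP[_ d0].
case: d d0 => // d _; rewrite [in RHS]big_ord_recl /= subr0 -(gG2 d.+1 d.+1) subrr.
rewrite big_mkcond big_ord_recl /= add0r mulrBl mul1r opprB addrA.
by congr (_ - _); rewrite addrC; congr (_ + _); apply: eq_bigr => i _.
Qed.

Lemma lattice_sum_prod r s :
  lattice_sum (fun u v => u ^+ r * v ^+ s) =
  (divisor_power_sum r * divisor_power_sum s) n.
Proof.
rewrite fpsME /lattice_sum.
rewrite (partition_big (fun q => inord (q.1.1 * q.1.2) : I) predT) //=.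
apply: eq_bigr => k _; have le_kn : (k <= n)%N by rewrite -ltnS.
rewrite /divisor_power_sum -(divisor_sum_pairs (fun d => d%:Z ^+ r) le_kn).
rewrite -(divisor_sum_pairs (fun d => d%:Z ^+ s) (leq_subr k n)).
rewrite big_distrlr /= pair_big /=; apply: eq_bigl => -[[a x] [b y]] /=.
apply/andP/andP.
  move=> [/and5P[-> -> -> -> /eqP axby] /eqP <-]; rewrite inordK ?eqxx //; last lia.
  by split=> //; apply/eqP; lia.
move=> [/and3P[-> -> /eqP axk] /and3P[-> -> /eqP byk]].
by split; [apply/eqP; lia | rewrite axk inord_val].
Qed.

End LatticeSum.

Let norm_form (u v : int) : int := u ^+ 2 + u * v + v ^+ 2.

Lemma norm_form_rotate u v : norm_form (- v) (u + v) = norm_form u v.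
Proof. by rewrite /norm_form; ring. Qed.

Lemma norm_formC u v : norm_form u v = norm_form v u.
Proof. by rewrite /norm_form; ring. Qed.

(** For g symmetric and invariant under the rotation (u, v) -> (- v, u + v) of
    order 6 one has g u (v - u) = g (u - v) v = g u (- v). The difference
    g u v - g u (- v) involves only products of odd powers of u and v, whose
    sums are convolutions of divisor sums. The invariants used below are
    polynomials in u^2 + u v + v^2 and (u v (u + v))^2. *)
Lemma lattice_sum_rotation n (g : int -> int -> int) (c : int) (P : nat -> int) :
    (forall u v, g (- v) (u + v) = g u v) -> (forall u v, g u v = g v u) ->
    (forall d : nat, c * (\sum_(u < d) g u%:Z (d%:Z - u%:Z)) = P d) ->
  c * lattice_sum n (fun u v => g u v - g u (- v)) =
  \sum_(1 <= d < n.+1 | (d %| n)%N) (P d - c * (n %/ d)%:Z * g d%:Z (- d%:Z)).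
Proof.
move=> gR gC gP.
have gE u v : g u (v - u) = g u (- v).
  by rewrite -[RHS]gR -[RHS]gR gC; congr g; ring.
have -> : lattice_sum n (fun u v => g u v - g u (- v)) =
          lattice_sum n g - lattice_sum n (fun u v => g u (- v)).
  by rewrite /lattice_sum sumrB.
rewrite lattice_sum_euclid => [|//|u v]; last first.
  by rewrite -gE -[RHS]gR; congr g; ring.
rewrite mulr_sumr; apply: eq_bigr => d _.
by rewrite mulrBr gP mulrA.
Qed.

Lemma lattice_sum_linear n (c d : int) (g h : int -> int -> int) :
  lattice_sum n (fun u v => c * g u v + d * h u v) =
  c * lattice_sum n g + d * lattice_sum n h.
Proof. by rewrite /lattice_sum !mulr_sumr -big_split. Qed.

Lemma eq_lattice_sum n (g h : int -> int -> int) :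
  (forall u v, g u v = h u v) -> lattice_sum n g = lattice_sum n h.
Proof. by move=> gh; apply: eq_bigr. Qed.

Local Notation S := divisor_power_sum.

Lemma theta_divisor_power_sum (r n : nat) :
  theta (S r) n = \sum_(1 <= d < n.+1 | (d %| n)%N) (n %/ d)%:Z * d%:Z ^+ r.+1.
Proof.
rewrite /theta /S mulr_sumr; apply: eq_bigr => d dn.
by rewrite natz -{1}(divnK dn) PoszM exprS mulrA.
Qed.

Lemma divisor_conv11 : 12 * (S 1 * S 1) = 5 * S 3 + S 1 - 6 * theta (S 1).
Proof.
have power_sum (d : int) (m : nat) :
    6 * (\sum_(u < m) norm_form u%:Z (d - u%:Z)) =
    m%:Z * (1 + 3 * d + 6 * d ^+ 2) - 3 * m%:Z ^+ 2 * (1 + d) + 2 * m%:Z ^+ 3.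
  elim: m => [|m IHm]; first by rewrite big_ord0; ring.
  by rewrite big_ord_recr mulrDr IHm /norm_form /= intS; ring.
apply: fpsP => n; have := lattice_sum_rotation n norm_form_rotate norm_formC
  (fun d => power_sum d d).
rewrite (@eq_lattice_sum n _
  (fun u v => 2 * (u ^+ 1 * v ^+ 1) + 0 * 0)); last first.
  by move=> u v; rewrite /norm_form; ring.
rewrite lattice_sum_linear lattice_sum_prod mul0r addr0 mulrA.
rewrite fps_natM => ->.
rewrite !fpsDE fpsNE !fps_natM theta_divisor_power_sum /S !mulr_sumr.
rewrite -big_split -sumrB; apply: eq_bigr => d _ /=.
by rewrite /norm_form; ring.
Qed.

Lemma divisor_conv13 :
  240 * (S 1 * S 3) = 21 * S 5 + 10 * S 3 - S 1 - 30 * theta (S 3).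
Proof.
have power_sum (d : int) (m : nat) :
    30 * (\sum_(u < m) norm_form u%:Z (d - u%:Z) ^+ 2) =
    m%:Z * (- 1 + 15 * d ^+ 2 + 30 * d ^+ 3 + 30 * d ^+ 4)
    - m%:Z ^+ 2 * (15 * d + 45 * d ^+ 2 + 30 * d ^+ 3)
    + m%:Z ^+ 3 * (10 + 30 * d + 30 * d ^+ 2)
    - m%:Z ^+ 4 * (15 + 15 * d) + 6 * m%:Z ^+ 5.
  elim: m => [|m IHm]; first by rewrite big_ord0; ring.
  by rewrite big_ord_recr mulrDr IHm /norm_form /= intS; ring.
apply: fpsP => n.
have := @lattice_sum_rotation n (fun u v => norm_form u v ^+ 2) _ _
  (fun u v => congr1 (fun x => x ^+ 2) (norm_form_rotate u v))
  (fun u v => congr1 (fun x => x ^+ 2) (norm_formC u v))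
  (fun d => power_sum d d).
rewrite (@eq_lattice_sum n _
  (fun u v => 4 * (u ^+ 1 * v ^+ 3) + 4 * (u ^+ 3 * v ^+ 1))); last first.
  by move=> u v; rewrite /norm_form; ring.
rewrite lattice_sum_linear !lattice_sum_prod [S 3 * S 1]mulrC -mulrDl mulrA.
rewrite fps_natM => ->.
rewrite !fpsDE !fpsNE !fps_natM theta_divisor_power_sum /S !mulr_sumr.
rewrite -big_split -!sumrB; apply: eq_bigr => d _ /=.
by rewrite /norm_form; ring.
Qed.

(** In degree 6 the symmetric invariants span a plane; g is the combination for
    which the divisor sums of exponent 7 cancel. *)
Lemma divisor_conv15_33 :
  504 * (S 1 * S 5) - 2400 * (S 3 * S 3) =
  21 * S 5 + 20 * S 3 + S 1 - 42 * theta (S 5).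
Proof.
pose g (u v : int) : int :=
  42 * norm_form u v ^+ 3 - 747 * (u * v * (u + v)) ^+ 2.
have power_sum (d : int) (m : nat) :
    2 * (\sum_(u < m) g u%:Z (d - u%:Z)) =
    m%:Z * (2 + 33 * d ^+ 2 - 165 * d ^+ 4 + 126 * d ^+ 5 + 84 * d ^+ 6)
    + m%:Z ^+ 2 * (21 * d + 600 * d ^+ 3 + 495 * d ^+ 4 - 126 * d ^+ 5)
    - m%:Z ^+ 3 * (14 + 330 * d ^+ 2 + 1200 * d ^+ 3 + 330 * d ^+ 4)
    + m%:Z ^+ 4 * (- 105 * d + 495 * d ^+ 2 + 600 * d ^+ 3)
    + m%:Z ^+ 5 * (42 + 126 * d - 198 * d ^+ 2)
    - m%:Z ^+ 6 * (42 + 42 * d) + 12 * m%:Z ^+ 7.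
  elim: m => [|m IHm]; first by rewrite big_ord0; ring.
  by rewrite big_ord_recr mulrDr IHm /g /norm_form /= intS; ring.
apply: fpsP => n.
have gR u v : g (- v) (u + v) = g u v by rewrite /g norm_form_rotate; ring.
have gC u v : g u v = g v u by rewrite /g norm_formC; ring.
(* With variable scalars no numerals of the ring of power series have to be
   compared by computation. *)
have coefL (a b : nat) (u v : fps int) :
    (a%:R * u - b%:R * v) n = a%:R * u n - b%:R * v n.
  by rewrite fpsDE fpsNE !fps_natM.
have coefR (a b c : nat) (u v w x : fps int) :
    (a%:R * u + b%:R * v + w - c%:R * x) n =
    a%:R * u n + b%:R * v n + w n - c%:R * x n.
  by rewrite !fpsDE fpsNE !fps_natM.
have := lattice_sum_rotation n gR gC (fun d => power_sum d d).
rewrite (@eq_lattice_sum n _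
  (fun u v => 1 * (252 * (u ^+ 1 * v ^+ 5) + 252 * (u ^+ 5 * v ^+ 1))
              + - 2400 * (u ^+ 3 * v ^+ 3))); last first.
  by move=> u v; rewrite /g /norm_form; ring.
rewrite lattice_sum_linear lattice_sum_linear !lattice_sum_prod [S 5 * S 1]mulrC.
rewrite -mulrDl mul1r mulNr.
rewrite coefL coefR => eq2.
apply: (@mulfI _ 2) => //; rewrite {}eq2 theta_divisor_power_sum /S !mulr_sumr.
rewrite -!big_split -sumrB mulr_sumr; apply: eq_bigr => d _ /=.
by rewrite /g /norm_form; ring.
Qed.

End DivisorSums.

(** * Eisenstein series and the Ramanujan system *)

Section Eisenstein.
Local Open Scope ring_scope.

Local Notation S := divisor_power_sum.

Definition eis2 : fps int := 1 - 24 * S 1.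
Definition eis4 : fps int := 1 + 240 * S 3.
Definition eis6 : fps int := 1 - 504 * S 5.

Lemma theta1 (R : comNzRingType) : theta (1 : fps R) = 0.
Proof. by rewrite -(rmorph1 (@fps_const R)) theta_const. Qed.

Lemma eq_of_multiple (R : comNzRingType) (a b c d k : R) :
  a = b -> c - d = k * (a - b) -> c = d.
Proof. by move=> ->; rewrite subrr mulr0 => /eqP; rewrite subr_eq0 => /eqP. Qed.

Lemma theta_eis2 : 12 * theta eis2 = eis2 ^+ 2 - eis4.
Proof.
rewrite /eis2 /eis4 raddfB /= theta1 theta_natM.
by apply: (eq_of_multiple (k := - 48) divisor_conv11); ring.
Qed.

Lemma theta_eis4 : 3 * theta eis4 = eis2 * eis4 - eis6.
Proof.
rewrite /eis2 /eis4 /eis6 raddfD /= theta1 theta_natM.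
by apply: (eq_of_multiple (k := 24) divisor_conv13); ring.
Qed.

Lemma theta_eis6 : 2 * theta eis6 = eis2 * eis6 - eis4 ^+ 2.
Proof.
rewrite /eis2 /eis4 /eis6 raddfB /= theta1 theta_natM.
by apply: (eq_of_multiple (k := - 24) divisor_conv15_33); ring.
Qed.

Section Normalized.
Variable K : fieldType.
Hypotheses (K2 : 2 != 0 :> K) (K3 : 3 != 0 :> K).

Definition eisK (e : fps int) : fps K := map_fps intr e.

Definition ram1 : fps K := fps_const (- 12^-1) * eisK eis2.
Definition ram2 : fps K := fps_const 12^-1 * eisK eis4.
Definition ram3 : fps K := fps_const (- 216^-1) * eisK eis6.

Lemma theta_eisK2 : 12 * theta (eisK eis2) = eisK eis2 ^+ 2 - eisK eis4.
Proof.
rewrite /eisK -map_fps_theta -rmorphXn -rmorphB -theta_eis2 rmorphM.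
by rewrite rmorph_nat.
Qed.

Lemma theta_eisK4 : 3 * theta (eisK eis4) = eisK eis2 * eisK eis4 - eisK eis6.
Proof.
rewrite /eisK -map_fps_theta -rmorphM -rmorphB -theta_eis4 rmorphM.
by rewrite rmorph_nat.
Qed.

Lemma theta_eisK6 :
  2 * theta (eisK eis6) = eisK eis2 * eisK eis6 - eisK eis4 ^+ 2.
Proof.
rewrite /eisK -map_fps_theta -rmorphM -rmorphXn -rmorphB -theta_eis6 rmorphM.
by rewrite rmorph_nat.
Qed.

Let K12 : 12 != 0 :> K.
Proof. by rewrite (_ : 12 = 2 * 2 * 3) ?mulf_neq0 //; ring. Qed.

Let K216 : 216 != 0 :> K.
Proof.
by rewrite (_ : 216 = 2 * 2 * 2 * 3 * 3 * 3) ?mulf_neq0 //; ring.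
Qed.

Lemma ramanujan_system :
  [/\ - theta ram1 = ram1 ^+ 2 - fps_const 12^-1 * ram2,
      - theta ram2 = 4 * (ram1 * ram2) - 6 * ram3 &
      - theta ram3 = 6 * (ram1 * ram3) - fps_const 3^-1 * ram2 ^+ 2].
Proof.
have thetaC c (u : fps K) : theta (fps_const c * u) = fps_const c * theta u.
  by rewrite thetaM theta_const mul0r add0r.
have prodC (c d : K) (u v : fps K) :
    (fps_const c * u) * (fps_const d * v) = fps_const (c * d) * (u * v).
  by rewrite rmorphM; ring.
have coef (u v : fps K) : u = v -> forall n, u n = v n by move=> ->.
have eq2 := coef _ _ theta_eisK2; have eq4 := coef _ _ theta_eisK4.
have eq6 := coef _ _ theta_eisK6.
rewrite /ram1 /ram2 /ram3 !thetaC !expr2 !prodC.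
split; apply: fpsP => n; move: (eq2 n) (eq4 n) (eq6 n) => {eq2 eq4 eq6};
  rewrite !expr2 !(fpsDE, fpsNE, fps_natM, fps_constM).
- move=> eq2 _ _; have -> : eisK eis4 n = 
    (eisK eis2 * eisK eis2) n - 12 * theta (eisK eis2) n by rewrite eq2; ring.
  by field.
- move=> _ eq4 _; have -> : eisK eis6 n =
    (eisK eis2 * eisK eis4) n - 3 * theta (eisK eis4) n by rewrite eq4; ring.
  by field; rewrite K12 K216.
- move=> _ _ eq6; have -> : (eisK eis4 * eisK eis4) n =
    (eisK eis2 * eisK eis6) n - 2 * theta (eisK eis6) n by rewrite eq6; ring.
  by field; rewrite K12 K3 K216.
Qed.

Lemma eis_coef (m n : nat) (u : fps int) :
  (1 + m%:R * u) n = (n == 0%N)%:R + m%:R * u n /\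
  (1 - m%:R * u) n = (n == 0%N)%:R - m%:R * u n.
Proof.
have one_n : (1 : fps int) n = (n == 0%N)%:R by rewrite fps1E; case: (n).
by rewrite !fpsDE fpsNE fps_natM one_n.
Qed.

Lemma divisor_power_sum01 r :
  divisor_power_sum r 0%N = 0 /\ divisor_power_sum r 1%N = 1.
Proof.
by rewrite /divisor_power_sum big_geq // big_mkcond big_nat1 /= expr1n.
Qed.

Lemma eisK_coef :
  [/\ eisK eis4 0%N = 1, eisK eis4 1%N = 240,
      eisK eis6 0%N = 1 & eisK eis6 1%N = - 504].
Proof.
have [S30 S31] := divisor_power_sum01 3.
have [S50 S51] := divisor_power_sum01 5.
rewrite /eisK /map_fps /eis4 /eis6 !(eis_coef _ _ _).1 !(eis_coef _ _ _).2.
rewrite S30 S31 S50 S51 !mulr0 !mulr1 /= add0r sub0r rmorphN /= !mulrz_nat.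
by split.
Qed.

Lemma ram_coef0 : [/\ ram1 0%N = - 12^-1, ram2 0%N = 12^-1 & ram3 0%N = - 216^-1].
Proof.
have [S1 _] := divisor_power_sum01 1.
have [S3 _] := divisor_power_sum01 3.
have [S5 _] := divisor_power_sum01 5.
rewrite /ram1 /ram2 /ram3 !fps_constM /eisK /map_fps /eis2 /eis4 /eis6.
rewrite !(eis_coef _ _ _).1 !(eis_coef _ _ _).2 S1 S3 S5 !mulr0 /=.
by split; apply: mulr1.
Qed.

Lemma ram_coef1 : [/\ ram1 1%N = 2, ram2 1%N = 20 & ram3 1%N = 7 / 3].
Proof.
have [_ S1] := divisor_power_sum01 1.
have [_ S3] := divisor_power_sum01 3.
have [_ S5] := divisor_power_sum01 5.
rewrite /ram1 /ram2 /ram3 !fps_constM /eisK /map_fps /eis2 /eis4 /eis6.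
rewrite !(eis_coef _ _ _).1 !(eis_coef _ _ _).2 S1 S3 S5 !mulr1 !sub0r !add0r.
by split; rewrite ?rmorphN /=; field; rewrite ?K12 ?K3 ?K216.
Qed.

End Normalized.
End Eisenstein.

Lemma p_integral_frac (p N : nat) (m : int) (x : rat) :
  prime p -> ~~ (p %| N) -> (x * N%:R = m%:~R)%R -> p_integral p x.
Proof.
move=> p_pr pN xN; apply: contra pN => /dvdn_trans; apply.
have eq_num : (numq x * N%:Z = m * denq x)%R.
  apply: (@intr_inj rat); rewrite !rmorphM /= -xN.
  rewrite -[X in (X * N%:R)%R](divq_num_den x).
  have d0 : ((denq x)%:~R != 0 :> rat)%R by rewrite intr_eq0 denq_neq0.
  by field.
have : (denq x %| (numq x * N%:Z)%R)%Z by rewrite eq_num dvdz_mull.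
rewrite Gauss_dvdzr; first by rewrite dvdzE.
by rewrite coprimezE coprime_sym coprime_num_den.
Qed.

Section Uniqueness.
Local Open Scope ring_scope.

Lemma ramanujan_solution_unique (t1 t2 t3 u1 u2 u3 : nat -> rat) :
    ramanujan_solution t1 t2 t3 -> ramanujan_solution u1 u2 u3 ->
  [/\ u1 =1 t1, u2 =1 t2 & u3 =1 t3].
Proof.
move=> [t_eq1 t_eq2 t_eq3 t10 t11] [u_eq1 u_eq2 u_eq3 u10 u11].
have mul0 (v w : nat -> rat) : fps_mul v w 0%N = (v 0%N * w 0%N).
  by rewrite /fps_mul big_ord1.
have eq0 : u1 0%N = t1 0%N /\ u2 0%N = t2 0%N /\ u3 0%N = t3 0%N.
  move: (t_eq1 0%N) (t_eq2 0%N) (u_eq1 0%N) (u_eq2 0%N).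
  rewrite /fps_theta !mul0 !mul0r t10 u10; lra.
suff eqn n : [/\ u1 n = t1 n, u2 n = t2 n & u3 n = t3 n].
  by split=> n; case: (eqn n).
elim/ltn_ind: n => -[|n] IHn; first by case: eq0 => ? [? ?].
pose mid (v w : nat -> rat) := (\sum_(i < n) v i.+1 * w (n - i)%N).
have mulS (v w : nat -> rat) :
    fps_mul v w n.+1 = v 0%N * w n.+1 + v n.+1 * w 0%N + mid v w.
  rewrite /fps_mul big_ord_recl big_ord_recr /= subn0 subnn -addrA.
  by congr (_ + _); rewrite addrC.
have eq_mid v w v' w' : (forall m, (m < n.+1)%N -> v m = v' m) ->
    (forall m, (m < n.+1)%N -> w m = w' m) -> mid v w = mid v' w'.
  move=> vv' ww'; apply: eq_bigr => i _.
  by rewrite vv' ?ww' // ltnS ?leq_subr.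
have [I1 I2 I3] : [/\ forall m, (m < n.+1)%N -> u1 m = t1 m,
    forall m, (m < n.+1)%N -> u2 m = t2 m & forall m, (m < n.+1)%N -> u3 m = t3 m].
  by split=> m /IHn[].
move: (t_eq1 n.+1) (t_eq2 n.+1) (t_eq3 n.+1) (u_eq1 n.+1) (u_eq2 n.+1) (u_eq3 n.+1).
rewrite !mulS (eq_mid _ _ _ _ I1 I1) (eq_mid _ _ _ _ I1 I2) (eq_mid _ _ _ _ I1 I3).
rewrite (eq_mid _ _ _ _ I2 I2).
move: (mid t1 t1) (mid t1 t2) (mid t1 t3) (mid t2 t2) => m11 m12 m13 m22.
have [t20 t30] : t2 0%N = 12^-1 /\ t3 0%N = - 216^-1.
  by move: (t_eq1 0%N) (t_eq2 0%N); rewrite /fps_theta !mul0 !mul0r t10; lra.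
case: eq0 => -> [-> ->]; rewrite t10 t20 t30 /fps_theta.
(* The difference of the two solutions at n.+1 lies in the kernel of M + n.+1,
   where M is the linear part of the system at the constant terms, and
   det (M + m) = m ^ 2 (m - 1). *)
move=> et1 et2 et3 eu1 eu2 eu3.
have [x [y [z [Ex Ey Ez]]]] : exists x y z : rat,
  [/\ u1 n.+1 = (t1 n.+1 + x), u2 n.+1 = (t2 n.+1 + y) &
      u3 n.+1 = (t3 n.+1 + z)].
  exists (u1 n.+1 - t1 n.+1), (u2 n.+1 - t2 n.+1), (u3 n.+1 - t3 n.+1).
  by split; rewrite addrC subrK.
have x_eq0 : n = 0%N -> x = 0.
  by move=> n0; move: Ex; rewrite n0 u11 t11; lra.
rewrite {}Ex {}Ey {}Ez in eu1 eu2 eu3 *.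
set m : rat := n.+1%:R in et1 et2 et3 eu1 eu2 eu3.
have dx : (y = (12 * m - 2) * x) by lra.
have dz : (z = (m / 6 - 18^-1) * y + 18^-1 * x) by lra.
have det0 : m ^+ 2 * (m - 1) * x = 0.
  have : m * z - 36^-1 * x - 18^-1 * y - 2^-1 * z = 0 by lra.
  by rewrite dz dx => eq_z; apply: (eq_of_multiple (k := 2^-1) eq_z); field.
have x0 : x = 0.
  case: (posnP n) => [/x_eq0 // | n_gt0].
  move/eqP: det0; rewrite mulf_eq0 mulf_eq0 expf_eq0 /= /m.
  rewrite pnatr_eq0 /= subr_eq0 pnatr_eq1 eqSS (gtn_eqF n_gt0) /=.
  by move/eqP.
have y0 : y = 0 by rewrite dx x0; apply: mulr0.
have z0 : z = 0 by rewrite dz y0 x0; lra.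
by rewrite x0 y0 z0; split; apply: addr0.
Qed.

End Uniqueness.

Lemma integrality_holds (p : nat) :
  prime p -> p <> 2 -> p <> 3 -> integrality_condition p.
Proof.
move=> p_pr p_neq2 p_neq3.
have Q2 : (2 != 0 :> rat)%R by []. 
have Q3 : (3 != 0 :> rat)%R by [].
have sol : ramanujan_solution (ram1 rat) (ram2 rat) (ram3 rat).
  have [eq1 eq2 eq3] := ramanujan_system Q2 Q3.
  have [t10 _ _] := ram_coef0 rat; have [t11 _ _] := ram_coef1 Q2 Q3.
  split=> // n.
  - move: (congr1 (fun u : fps rat => u n) eq1) => /=.
    by rewrite expr2 fpsDE !fpsNE fps_constM.
  - move: (congr1 (fun u : fps rat => u n) eq2) => /=.
    by rewrite fpsDE !fpsNE !fps_natM.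
  - move: (congr1 (fun u : fps rat => u n) eq3) => /=.
    by rewrite expr2 fpsDE !fpsNE fps_natM fps_constM.
have coprime_p e f : ~~ (p %| 2 ^ e * 3 ^ f).
  rewrite Euclid_dvdM // negb_or !Euclid_dvdX // !dvdn_prime2 //.
  by rewrite !negb_and; apply/andP; split; apply/orP; left; apply/eqP.
exists (ram1 rat), (ram2 rat), (ram3 rat); split=> //.
  by move=> u1 u2 u3 sol_u; apply: ramanujan_solution_unique.
split=> n.
- apply: (@p_integral_frac p 12 (- eis2 n)) => //; first exact: (coprime_p 2 1).
  by rewrite /ram1 fps_constM /eisK /map_fps rmorphN /=; field.
- apply: (@p_integral_frac p 12 (eis4 n)) => //; first exact: (coprime_p 2 1).
  by rewrite /ram2 fps_constM /eisK /map_fps /=; field.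
- apply: (@p_integral_frac p 216 (- eis6 n)) => //; first exact: (coprime_p 3 3).
  by rewrite /ram3 fps_constM /eisK /map_fps rmorphN /=; field.
Qed.

(** * The Serre derivative and powers of the Ramanujan derivation *)

Section Bivariate.
Local Open Scope ring_scope.

Definition derivation (S : comNzRingType) (D : S -> S) : Prop :=
  (forall u v, D (u + v) = D u + D v) /\
  (forall u v, D (u * v) = D u * v + u * D v).

Lemma derivation0 (S : comNzRingType) (D : S -> S) : derivation D -> D 0 = 0.
Proof. by case=> DD _; apply: (addrI (D 0)); rewrite -DD !addr0. Qed.

Lemma derivationN (S : comNzRingType) (D : S -> S) u :
  derivation D -> D (- u) = - D u.
Proof.
move=> derD; apply: (addIr (D u)).
by rewrite -derD.1 !addNr derivation0.
Qed.

Lemma derivation_nat (S : comNzRingType) (D : S -> S) (m : nat) u :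
  derivation D -> D (m%:R * u) = m%:R * D u.
Proof.
move=> derD; have D0 := derivation0 derD; case: derD => DD _.
by elim: m => [|m IHm]; rewrite ?mul0r // -addn1 natrD !mulrDl !mul1r DD IHm.
Qed.

Lemma derivationX (S : comNzRingType) (D : S -> S) u m :
  derivation D -> D (u ^+ m) = m%:R * u ^+ m.-1 * D u.
Proof.
case=> DD DM; have D1 : D 1 = 0.
  by apply: (addrI (D 1)); rewrite addr0 -{3}[1]mulr1 DM mulr1 mul1r.
case: m => [|m /=]; first by rewrite expr0 D1 !mul0r.
elim: m => [|m IHm]; first by rewrite expr0 !mul1r.
by rewrite exprS DM IHm !exprS -!natr1; ring.
Qed.

Lemma derivationB (S : comNzRingType) (D : S -> S) u v :
  derivation D -> D (u - v) = D u - D v.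
Proof. by move=> derD; rewrite derD.1 derivationN. Qed.

Variable k : fieldType.
Local Notation B := {poly {poly k}}.
Local Notation x := ('X%:P : B).
Local Notation y := ('X : B).

Lemma bivariate_ind (P : B -> Prop) :
    (forall a, P a%:P%:P) -> P x -> P y ->
    (forall u v, P u -> P v -> P (u + v)) ->
    (forall u v, P u -> P v -> P (u * v)) ->
  forall u, P u.
Proof.
move=> Pc Px Py PD PM; have PC (g : {poly k}) : P g%:P.
  elim/poly_ind: g => [|g a IHg]; first by rewrite -polyC0; apply: (Pc 0).
  by rewrite polyCD polyCM; apply/PD/Pc/PM.
elim/poly_ind => [|g a IHg]; first by rewrite -[0]polyC0; apply: PC.
by apply/PD/PC/PM.
Qed.

Section Eval.
Variables (S : comNzRingType) (c : {rmorphism k -> S}) (s t : S).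

Definition biv_eval : B -> S :=
  horner_eval t \o map_poly (horner_eval s \o map_poly c).

Arguments biv_eval : simpl never.

HB.instance Definition _ := GRing.RMorphism.copy biv_eval
  (horner_eval t \o map_poly (horner_eval s \o map_poly c)).

Lemma biv_evalC a : biv_eval a%:P%:P = c a.
Proof.
by rewrite /biv_eval /= map_polyC /= map_polyC /= /horner_eval !hornerC.
Qed.

Lemma biv_evalX : biv_eval x = s.
Proof. by rewrite /biv_eval /= map_polyC /= map_polyX /horner_eval hornerC hornerX. Qed.

Lemma biv_evalY : biv_eval y = t.
Proof. by rewrite /biv_eval /= map_polyX /horner_eval hornerX. Qed.

Lemma biv_eval_polyC (f : {poly k}) : biv_eval f%:P = (map_poly c f).[s].
Proof. by rewrite /biv_eval /= map_polyC /= /horner_eval hornerC. Qed.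

Lemma biv_evalM u v : biv_eval (u * v) = biv_eval u * biv_eval v.
Proof. exact: rmorphM. Qed.

Lemma biv_evalD u v : biv_eval (u + v) = biv_eval u + biv_eval v.
Proof. exact: rmorphD. Qed.

Lemma biv_evalB u v : biv_eval (u - v) = biv_eval u - biv_eval v.
Proof. exact: rmorphB. Qed.

Lemma biv_evalN u : biv_eval (- u) = - biv_eval u.
Proof. exact: rmorphN. Qed.

Lemma biv_eval_exp u m : biv_eval (u ^+ m) = biv_eval u ^+ m.
Proof. exact: rmorphXn. Qed.

Lemma biv_eval_nat m : biv_eval m%:R = m%:R.
Proof. exact: rmorph_nat. Qed.

End Eval.

Lemma rmorph_biv_eval (S S' : comNzRingType) (c : {rmorphism k -> S})
    (c' : {rmorphism k -> S'}) (f : {rmorphism S -> S'}) s t u :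
  (forall a, f (c a) = c' a) ->
  f (biv_eval c s t u) = biv_eval c' (f s) (f t) u.
Proof.
move=> fc; elim/bivariate_ind: u => [a|||u v IHu IHv|u v IHu IHv].
- by rewrite !biv_evalC.
- by rewrite !biv_evalX.
- by rewrite !biv_evalY.
- by rewrite !rmorphD /= IHu IHv.
- by rewrite !rmorphM /= IHu IHv.
Qed.

Lemma biv_eval_swap (S : comNzRingType) (c : {rmorphism k -> S}) s t u :
  biv_eval c t s (swapXY u) = biv_eval c s t u.
Proof.
elim/bivariate_ind: u => [a|||u v IHu IHv|u v IHu IHv].
- by rewrite swapXY_polyC map_polyC /= !biv_evalC.
- by rewrite swapXY_polyC map_polyX biv_evalX biv_evalY.
- by rewrite swapXY_X biv_evalX biv_evalY.
- by rewrite rmorphD /= !biv_evalD IHu IHv.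
- by rewrite rmorphM /= !biv_evalM IHu IHv.
Qed.

Definition dx (u : B) : B := swapXY (swapXY u)^`().
Definition dy (u : B) : B := u^`().

Lemma dx_derivation : derivation dx.
Proof.
by split=> u v; rewrite /dx ?rmorphM ?rmorphD ?derivM ?derivD ?rmorphD //= ?rmorphM
  /= ?swapXYK.
Qed.

Lemma dy_derivation : derivation dy.
Proof. by split=> u v; rewrite /dy ?derivM ?derivD. Qed.

Lemma biv_eval_chain (S : comNzRingType) (c : {rmorphism k -> S}) s t
    (D : S -> S) u : derivation D -> (forall a, D (c a) = 0) ->
  D (biv_eval c s t u) =
  biv_eval c s t (dx u) * D s + biv_eval c s t (dy u) * D t.
Proof.
case=> DD DM Dc; have [xD xM] := dx_derivation; have [yD yM] := dy_derivation.
elim/bivariate_ind: u => [a|||u v IHu IHv|u v IHu IHv].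
- rewrite biv_evalC Dc /dx /dy derivC swapXY_polyC map_polyC /= derivC.
  by rewrite !rmorph0 !mul0r addr0.
- rewrite biv_evalX /dx /dy derivC swapXY_polyC map_polyX derivX.
  by rewrite rmorph1 !rmorph0 rmorph1 mul0r mul1r addr0.
- rewrite biv_evalY /dx /dy derivX swapXY_X derivC.
  by rewrite !rmorph0 rmorph1 mul0r mul1r add0r.
- by rewrite xD yD !rmorphD /= DD IHu IHv; ring.
- by rewrite xM yM !rmorphD !rmorphM /= DM IHu IHv; ring.
Qed.

(** With x, y in the roles of E_4, E_6 these are the Serre derivative
    12 q d/dq - E_2 (weight) and the derivation scaling by the weight. *)
Definition serre (u : B) : B := - (4 * y * dx u + 6 * x ^+ 2 * dy u).
Definition weight (u : B) : B := 4 * x * dx u + 6 * y * dy u.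

Lemma serre_derivation : derivation serre.
Proof.
have [xD xM] := dx_derivation; have [yD yM] := dy_derivation.
by split=> u v; rewrite /serre ?xD ?yD ?xM ?yM; ring.
Qed.

Lemma weight_derivation : derivation weight.
Proof.
have [xD xM] := dx_derivation; have [yD yM] := dy_derivation.
by split=> u v; rewrite /weight ?xD ?yD ?xM ?yM; ring.
Qed.

Lemma dxX : dx x = 1. Proof. by rewrite /dx swapXY_polyC map_polyX derivX rmorph1. Qed.
Lemma dxY : dx y = 0. Proof. by rewrite /dx swapXY_X derivC rmorph0. Qed.
Lemma dyX : dy x = 0. Proof. by rewrite /dy derivC. Qed.
Lemma dyY : dy y = 1. Proof. by rewrite /dy derivX. Qed.
Lemma dxC a : dx a%:P%:P = 0.
Proof. by rewrite /dx swapXY_polyC map_polyC /= derivC rmorph0. Qed.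
Lemma dyC a : dy a%:P%:P = 0. Proof. by rewrite /dy derivC. Qed.

Lemma weightX : weight x = 4 * x.
Proof. by rewrite /weight dxX dyX; ring. Qed.

Lemma weightY : weight y = 6 * y.
Proof. by rewrite /weight dxY dyY; ring. Qed.

Lemma serreX : serre x = - (4 * y).
Proof. by rewrite /serre dxX dyX; ring. Qed.

Lemma serreY : serre y = - (6 * x ^+ 2).
Proof. by rewrite /serre dxY dyY; ring. Qed.

Lemma weightC a : weight a%:P%:P = 0.
Proof. by rewrite /weight dxC dyC !mulr0 addr0. Qed.

Lemma weight_serre u : weight (serre u) = serre (weight u) + 2 * serre u.
Proof.
have [wD wM] := weight_derivation; have [sD sM] := serre_derivation.
have wN v := derivationN v weight_derivation.
elim/bivariate_ind: u => [a|||u v IHu IHv|u v IHu IHv].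
- have -> : serre a%:P%:P = 0 by rewrite /serre dxC dyC; ring.
  rewrite weightC (derivation0 weight_derivation).
  by rewrite (derivation0 serre_derivation); ring.
- rewrite weightX serreX wN (derivation_nat _ _ weight_derivation) weightY.
  by rewrite (derivation_nat _ _ serre_derivation) serreX; ring.
- rewrite weightY serreY wN (derivation_nat _ _ weight_derivation).
  rewrite (derivation_nat _ _ serre_derivation) serreY.
  by rewrite (derivationX _ _ weight_derivation) weightX; ring.
- by rewrite sD !wD IHu IHv sD sD; ring.
- by rewrite wM sM wD sD !sM !wM IHu IHv; ring.
Qed.

(* The parametrization of the cuspidal curve x ^ 3 = y ^ 2; there the Serre
   derivative becomes the derivation - s ^ 3 d/ds of k[s]. *)
Local Notation cusp := (biv_eval (@polyC k) 'X^4 'X^6).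

Section Iterates.
Variables (K : nat) (g : B).

(** The constant terms, as polynomials in E_2, of the iterated derivatives of a
    modular form g of weight K.+1; the correction term of the recursion is due
    to D E_2 = E_2 ^ 2 - E_4 for D = 12 q d/dq. *)
Fixpoint serre_iter (n : nat) : B :=
  if n is n1.+1 then
    if n1 is n2.+1 then
      serre (serre_iter n1) - (n1 * (K + n1))%:R * x * serre_iter n2
    else serre (serre_iter n1)
  else g.

Lemma serre_iterE n : serre_iter n.+1 =
  serre (serre_iter n) - (n * (K + n))%:R * x * serre_iter n.-1.
Proof. by case: n => [|n] //=; rewrite mul0n !mul0r subr0. Qed.

Hypothesis weight_g : weight g = K.+1%:R * g.

Lemma weight_serre_iter n :
  weight (serre_iter n) = (K.+1 + n.*2)%:R * serre_iter n.
Proof.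
have wD := weight_derivation.
suff: weight (serre_iter n) = (K.+1 + n.*2)%:R * serre_iter n /\
      weight (serre_iter n.+1) = (K.+1 + n.+1.*2)%:R * serre_iter n.+1 by case.
elim: n => [|n [IHn IHn1]].
  rewrite /= addn0 weight_serre weight_g; split=> //.
  by rewrite (derivation_nat _ _ serre_derivation) -mul2n natrD natrM; ring.
split=> //; rewrite serre_iterE (derivationB _ _ wD) weight_serre IHn1 -mulrA.
rewrite (derivation_nat _ _ serre_derivation) (derivation_nat _ _ wD).
rewrite wD.2 weightX IHn /= -!mul2n -!natr1 !(natrD, natrM) -!natr1; ring.
Qed.

Section Expansion.
Variables (S : comNzRingType) (c : {rmorphism k -> S}) (D : S -> S).
Variables e2 e4 e6 : S.
Hypotheses (D_der : derivation D) (Dc : forall a, D (c a) = 0).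
Hypothesis De4 : D e4 = 4 * (e2 * e4 - e6).
Hypothesis De6 : D e6 = 6 * (e2 * e6 - e4 ^+ 2).
Local Notation ev := (biv_eval c e4 e6).

Lemma derive_eval u : D (ev u) = ev (serre u) + e2 * ev (weight u).
Proof.
rewrite biv_eval_chain // De4 De6 /serre /weight.
rewrite !(biv_evalN, biv_evalD, biv_evalM, biv_eval_exp, biv_eval_nat).
by rewrite biv_evalX biv_evalY; ring.
Qed.

Hypothesis De2 : D e2 = e2 ^+ 2 - e4.

Lemma iter_derive_eval n : iter n D (ev g) =
  \sum_(j < n.+1) ('C(n, j) * (K + n) ^_ j)%:R *
    (e2 ^+ j * ev (serre_iter (n - j))).
Proof.
pose z j m := e2 ^+ j * ev (serre_iter m).
pose a m j := ('C(m, j) * (K + m) ^_ j)%N.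
have D_z j m : D (z j m) =
    (j + (K.+1 + m.*2))%:R * z j.+1 m + z j m.+1
    + e4 * ((m * (K + m))%:R * z j m.-1 - j%:R * z j.-1 m).
  rewrite /z D_der.2 derivationX // De2 derive_eval (weight_serre_iter m).
  have -> : ev (serre (serre_iter m)) = ev (serre_iter m.+1) +
      (m * (K + m))%:R * e4 * ev (serre_iter m.-1).
    rewrite serre_iterE rmorphB !rmorphM /= !rmorph_nat biv_evalX; ring.
  rewrite (rmorphM ev) rmorph_nat natrD; case: j => [|j] /=; last rewrite !exprS.
    by ring.
  by ring.
elim: n => [|n IHn].
  by rewrite big_ord1 bin0 ffactn0 subn0 mul1r mul1r.
have D_sum m (F : nat -> S) :
    D (\sum_(j < m) F j) = \sum_(j < m) D (F j).
  elim: m => [|m IHm]; first by rewrite !big_ord0 derivation0.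
  by rewrite !big_ord_recr /= D_der.1 IHm.
rewrite iterS {}IHn (D_sum _ (fun j => (a n j)%:R * z j (n - j)%N)).
under eq_bigr do rewrite derivation_nat // D_z mulrDr mulrDr.
rewrite !big_split /=.
(* The terms containing e4 cancel in pairs. *)
have -> : \sum_(j < n.+1) (a n j)%:R * (e4 *
    (((n - j) * (K + (n - j)))%:R * z j (n - j).-1 - j%:R * z j.-1 (n - j)%N)) = 0.
  under eq_bigr do rewrite mulrBr mulrBr.
  rewrite sumrB big_ord_recr [X in _ - X]big_ord_recl /= subnn !mul0n.
  rewrite !mul0r !mulr0 addr0 add0r -sumrB big1 // => i _.
  rewrite /bump /= add1n add0n.
  have le_in : (i < n)%N := ltn_ord i.
  have eq_a : (a n i * ((n - i) * (K + (n - i))) = a n i.+1 * i.+1)%N.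
    rewrite /a ffactnSr; have := mul_bin_left n i.
    rewrite (_ : K + (n - i) = K + n - i)%N; last lia.
    move: ('C(n, i.+1)) ('C(n, i)) ((K + n) ^_ i) => C1 C0 f eqC.
    transitivity ((n - i) * C0 * (f * (K + n - i)))%N; first by lia.
    by rewrite -eqC; lia.
  have eq_aS : (a n i)%:R * ((n - i) * (K + (n - i)))%:R =
      (a n i.+1)%:R * i.+1%:R :> S by rewrite -!natrM eq_a.
  rewrite subnS; transitivity (e4 * z i (n - i).-1 * ((a n i)%:R *
    ((n - i) * (K + (n - i)))%:R - (a n i.+1)%:R * i.+1%:R)).
    by ring.
  by rewrite eq_aS subrr mulr0.
rewrite addr0 [X in _ + X]big_ord_recl [RHS]big_ord_recl /= !subn0.
rewrite addrCA; congr (_ + _); first by rewrite /a !bin0 !ffactn0.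
rewrite [X in _ + X](_ : _ = \sum_(i < n.+1) (a n i.+1)%:R * z i.+1 (n - i)%N).
  rewrite -big_split /=; apply: eq_bigr => i _; rewrite /bump /= add1n subSS.
  have le_in : (i <= n)%N by rewrite -ltnS.
  rewrite mulrA -mulrDl -natrM -natrD; congr (_%:R * _).
  rewrite /a addnS binS ffactSS ffactnSr; have := mul_bin_left n i.
  move: ('C(n, i.+1)) ('C(n, i)) ((K + n) ^_ i) => C1 C0 f eqC.
  have -> : (K + n - i = K + (n - i))%N by lia.
  have: (n = i + (n - i))%N by lia.
  move: (n - i)%N eqC => d /(congr1 (muln f)) eqC En.
  rewrite [X in (_ * ((K + X).+1 * _))%N]En.
  by rewrite -addnn; lia.
have a_top : a n n.+1 = 0%N by rewrite /a bin_small.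
rewrite [RHS]big_ord_recr /= a_top mul0r addr0.
by apply: eq_bigr => i _; rewrite /bump /= add1n subnSK.
Qed.

(** The binomial coefficient vanishes modulo p for 0 < j < p, the product of p
    consecutive integers for j = p. *)
Lemma iter_prime_derive_eval p : p \in [pchar k] ->
  iter p D (ev g) = ev (serre_iter p).
Proof.
move=> p_char; have p_pr := pcharf_prime p_char.
have pS m : (p %| m)%N -> m%:R = 0 :> S.
  case/dvdnP=> q ->; rewrite natrM -(rmorph_nat c p) (pcharf0 p_char).
  by rewrite rmorph0 mulr0.
rewrite iter_derive_eval big_ord_recl /= subn0 bin0 ffactn0 !mul1r.
rewrite big1 ?addr0 // => i _; rewrite pS ?mul0r // /bump /= add1n.
case: (ltngtP i.+1 p) (ltn_ord i) => // [lt_ip _ | -> _].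
  by rewrite dvdn_mulr // prime_dvd_bin.
by rewrite -bin_ffact dvdn_mull // dvdn_mull // dvdn_fact ?prime_gt0 /=.
Qed.

End Expansion.

Lemma cusp_serre_iter n :
    cusp g = 'X^(K.+1) ->
  cusp (serre_iter n) =
  (-1) ^+ n * ((K + n) ^_ n)%:R * 'X^(K.+1 + n.*2).
Proof.
move=> g_cusp.
pose D (u : {poly k}) := - 'X^3 * u^`().
have D_der : derivation D.
  by split=> u v; rewrite /D ?derivD ?derivM; ring.
have Dc a : D a%:P = 0 by rewrite /D derivC mulr0.
have DX m : D 'X^m = - (m%:R * 'X^(m + 2)).
  rewrite /D derivXn -mulr_natl; case: m => [|m /=].
    by rewrite !mul0r mulr0 oppr0.
  by rewrite addSnnS exprD; ring.
have ev_serre u : cusp (serre u) = D (cusp u).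
  rewrite (@derive_eval _ (@polyC k) D 0 'X^4 'X^6) ?mul0r ?addr0 //.
    by rewrite DX; ring.
  by rewrite DX -exprM; ring.
suff: cusp (serre_iter n) = (-1) ^+ n * ((K + n) ^_ n)%:R * 'X^(K.+1 + n.*2) /\
      cusp (serre_iter n.+1) =
        (-1) ^+ n.+1 * ((K + n.+1) ^_ n.+1)%:R * 'X^(K.+1 + n.+1.*2) by case.
elim: n => [|n [IHn IHn1]].
  rewrite ev_serre /= g_cusp ffactn0 !addn0 DX addn1 addn2 ffactn1.
  by split; ring.
have Dsign m u : D ((-1) ^+ m * u) = (-1) ^+ m * D u.
  by rewrite -signr_odd; case: odd; rewrite ?mul1r // !mulN1r derivationN.
split=> //; rewrite serre_iterE biv_evalB ev_serre 2!biv_evalM.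
rewrite biv_eval_nat biv_evalX IHn1 IHn.
have Dterm m N M : D ((-1) ^+ m * N%:R * 'X^M) =
    - ((-1) ^+ m * N%:R * M%:R * 'X^(M + 2)).
  by rewrite -[in LHS]mulrA Dsign (derivation_nat _ _ D_der) DX; ring.
rewrite Dterm !(addnS K) !ffactSS !(exprS (-1)).
have -> : (K.+1 + n.+2.*2 = K.+1 + n.*2 + 4)%N by lia.
have -> : (K.+1 + n.+1.*2 = K.+1 + n.*2 + 2)%N by lia.
move: ((K + n) ^_ n) ((-1) ^+ n) => F0 sgn.
have -> : (K.+1 + n.*2 + 2)%:R = (K + n)%:R + n%:R + 3 :> {poly k}.
  by rewrite -!natrD; congr (_%:R); lia.
move: (K.+1 + n.*2)%N => M.
rewrite !natrM -!natr1 !exprD; ring.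
Qed.

End Iterates.

Lemma cusp_eq0_dvd u :
  cusp u = 0 -> exists v, u = (x ^+ 3 - y ^+ 2) * v.
Proof.
move=> ev0; pose d : B := 'X^2 - ('X^3)%:P.
have size_d : size d = 3.
  rewrite /d size_polyDl ?size_polyXn // size_polyN ltnS.
  by rewrite (leq_trans (size_polyC_leq1 _)).
have monic_d : d \is monic.
  by rewrite monicE lead_coefE size_d /d coefB coefXn coefC /= subr0.
pose q := Pdiv.Ring.rdivp u d; pose r := Pdiv.Ring.rmodp u d.
have size_r : (size r < 3)%N.
  have := @Pdiv.Ring.ltn_rmodpN0 _ u d (monic_neq0 monic_d).
  by rewrite size_d.
have u_div : u = q * d + r := Pdiv.RingMonic.rdivp_eq monic_d u.
have ev_d : cusp d = 0.
  rewrite biv_evalB biv_eval_exp biv_evalY polyC_exp biv_eval_exp biv_evalX.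
  by rewrite -!exprM subrr.
have r_def : r = (r`_0)%:P + (r`_1)%:P * 'X.
  apply/polyP=> i; rewrite coefD coefC coefMX coefC.
  case: i => [|[|i]] /=; rewrite ?addr0 ?add0r //.
  by rewrite nth_default // -ltnS (leq_trans size_r).
have evC (f : {poly k}) : cusp f%:P = f \Po 'X^4.
  by rewrite /biv_eval /= map_polyC /= /horner_eval hornerC.
move: ev0; rewrite u_div rmorphD rmorphM /= ev_d mulr0 add0r r_def rmorphD rmorphM /=.
rewrite !evC biv_evalY => ev0.
(* The exponents of 'X in the two terms are congruent to 0 and to 2 mod 4. *)
have r0 : r`_0 = 0.
  apply/polyP => i; have := congr1 (fun f : {poly k} => f`_(4 * i)) ev0.
  rewrite coefD coefMXn !coef_comp_poly_Xn // dvdn_mulr // mulKn // !coef0.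
  case: ltnP => [_ | le6]; first by rewrite addr0.
  suff -> : (4 %| 4 * i - 6)%N = false by rewrite addr0.
  by apply/negP => /dvdnP[m]; lia.
have r1 : r`_1 = 0.
  apply/polyP => i; have := congr1 (fun f : {poly k} => f`_(4 * i + 6)) ev0.
  rewrite r0 comp_poly0 add0r coefMXn coef_comp_poly_Xn // !coef0.
  by rewrite ltnNge leq_addl /= addnK dvdn_mulr // mulKn.
exists (- q); rewrite r0 r1 polyC0 mul0r !addr0 /d.
by rewrite polyC_exp; ring.
Qed.

End Bivariate.

(** * Elimination and Frobenius modulo prime ideals *)

Section PrimeIdeals.
Local Open Scope ring_scope.
Variable A : comNzRingType.

Section OneIdeal.
Variable P : {pred A}.
Hypothesis P_ideal : idealr_closed P.

Lemma ideal0 : 0 \in P. Proof. by case: P_ideal. Qed.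

Lemma ideal1 : 1 \notin P. Proof. by case: P_ideal. Qed.

Lemma idealMl a u : u \in P -> a * u \in P.
Proof.
by case: P_ideal => P0 _ PDM Pu; rewrite -[_ * _]addr0; apply: PDM.
Qed.

Lemma idealD u v : u \in P -> v \in P -> u + v \in P.
Proof. by case: P_ideal => P0 _ PDM Pu Pv; rewrite -[u]mul1r; apply: PDM. Qed.

Lemma idealN u : u \in P -> - u \in P.
Proof. by move=> Pu; rewrite -mulN1r; apply: idealMl. Qed.

Lemma idealB u v : u \in P -> v \in P -> u - v \in P.
Proof. by move=> Pu Pv; apply/idealD/idealN. Qed.

Lemma idealBE u v : u - v \in P -> (u \in P) = (v \in P).
Proof.
move=> Puv; apply/idP/idP => [Pu | Pv]; last by rewrite -(subrK v u); apply: idealD.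
by rewrite -[v](subKr u); apply: idealB.
Qed.

Lemma idealX u v n : u - v \in P -> u ^+ n - v ^+ n \in P.
Proof. by move=> Puv; rewrite subrXX mulrC; apply: idealMl. Qed.

Hypothesis P_prime : prime_idealr_closed P.

Lemma prime_ideal_exp u m : u ^+ m \in P -> u \in P.
Proof.
elim: m => [|m IHm]; first by rewrite expr0 (negPf ideal1).
by rewrite exprS => /P_prime/orP[].
Qed.

End OneIdeal.

(** Two coprime polynomials in y over k[x] generate an ideal that meets k[x].
    If F has minimal degree in y among the elements of the prime ideal I, then a
    common factor of F and G would give an element of I of smaller degree, unless
    I itself meets k[x]. *)
Lemma prime_elimination (k : fieldType) (c : {rmorphism k -> A}) (s t : A)
    (I P : {pred A}) (F G : {poly {poly k}}) :
    prime_ideal I -> prime_ideal P -> {subset I <= P} ->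
    F != 0 -> biv_eval c s t F \in I ->
    biv_eval c s t G \in P -> biv_eval c s t G \notin I ->
  exists2 f : {poly k}, f != 0 & biv_eval c s t f%:P \in P.
Proof.
set ev := biv_eval c s t.
have evM u v : ev (u * v) = ev u * ev v by apply: biv_evalM.
have evD u v : ev (u + v) = ev u + ev v by apply: biv_evalD.
move=> [I_ideal I_prime] [P_ideal P_prime] sIP F_neq0 IF PG nIG.
have [[f f_neq0 If] | no_f] :=
    boolp.pselect (exists2 f : {poly k}, f != 0 & ev f%:P \in I).
  by exists f => //; apply: sIP.
have I_neq0 f : f != 0 -> ev f%:P \notin I.
  by move=> f_neq0; apply/negP => If; apply: no_f; exists f.
have ex_m : exists m, boolp.asbool
    (exists F1 : {poly {poly k}}, [/\ F1 != 0, ev F1 \in I & size F1 = m]).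
  by exists (size F); apply/boolp.asboolP; exists F.
case: (ex_minnP ex_m) => m /boolp.asboolP[F1 [F1_neq0 IF1 sizeF1]] min_m.
have [/Bezout_coprimepP[[u v] /eqpP[[a b] /andP[/= a_neq0 b_neq0]]] | ncop] :=
    boolP (coprimep F1 G).
  rewrite -!mul_polyC mulr1 => ab; exists b => //.
  rewrite -ab evM evD !evM.
  by apply: (idealMl P_ideal); apply: (idealD P_ideal); apply: (idealMl P_ideal);
    first exact: sIP.
have d_neq0 : gcdp F1 G != 0 by rewrite gcdp_eq0 (negPf F1_neq0).
have [[a u] /= a_neq0 aF1] := Pdiv.Idomain.dvdpP _ _ (dvdp_gcdl F1 G).
have [[b w] /= b_neq0 bG] := Pdiv.Idomain.dvdpP _ _ (dvdp_gcdr F1 G).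
have aF1_neq0 : a *: F1 != 0 by rewrite scale_poly_eq0 negb_or a_neq0.
have u_neq0 : u != 0.
  by apply: contra_neq aF1_neq0 => u0; rewrite aF1 u0 mul0r.
have I_ud : ev u * ev (gcdp F1 G) \in I.
  by rewrite -evM -aF1 -mul_polyC evM; apply: (idealMl I_ideal).
case/orP: (I_prime _ _ I_ud) => [Iu | Id].
  have : (m <= size u)%N by apply: min_m; apply/boolp.asboolP; exists u.
  rewrite leqNgt => /negP[]; rewrite -sizeF1 -(size_scale F1 a_neq0) aF1 size_mul //.
  have : (1 < size (gcdp F1 G))%N.
    have := ncop; rewrite /coprimep; have := d_neq0; rewrite -size_poly_eq0.
    by case: (size _) => [|[|]].
  have := u_neq0; rewrite -size_poly_eq0 => su sd.
  by clear -su sd; move: (size u) (size _) su sd => [|n1] [|[|n2]] //; lia.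
have : ev b%:P * ev G \in I.
  by rewrite -evM mul_polyC bG evM; apply: (idealMl I_ideal).
by case/I_prime/orP => [/(negP (I_neq0 _ b_neq0)) | /(negP nIG)].
Qed.

End PrimeIdeals.

Lemma Fp_frobenius (p : nat) (a : 'F_p) : prime p -> (a ^+ p = a)%R.
Proof.
move=> p_pr; rewrite -{1}[a]natr_Zp -[RHS]natr_Zp.
exact: (pFrobenius_aut_nat (pchar_Fp p_pr)).
Qed.

Section FiniteField.
Local Open Scope ring_scope.
Variables (p : nat) (A : comNzRingType) (c : {rmorphism 'F_p -> A}).
Hypothesis p_pr : prime p.
Local Notation k := 'F_p.

Let A_char : p \in [pchar A].
Proof.
apply/andP; split=> //; rewrite -(rmorph_nat c) (pcharf0 (pchar_Fp p_pr)).
by rewrite rmorph0.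
Qed.

Lemma frobeniusD (M : nat) (u v : A) :
  (u + v) ^+ (p ^ M) = u ^+ (p ^ M) + v ^+ (p ^ M).
Proof. by apply: exprDn_pchar; rewrite pnatX pnatE // A_char. Qed.

(** There are finitely many remainders modulo f, so that two of the powers
    X^(p^i) are congruent; a common Frobenius power can be removed from the
    congruence modulo a prime. *)
Lemma frobenius_periodic (P : {pred A}) (f : {poly k}) (s : A) :
    prime_ideal P -> f != 0 -> (map_poly c f).[s] \in P ->
  exists2 M, (0 < M)%N & s ^+ (p ^ M) - s \in P.
Proof.
move=> [P_ideal P_prime] f_neq0 Pf.
pose T := {ffun 'I_(size f) -> k}.
pose res (i : nat) : T := [ffun j : 'I_(size f) => ('X^(p ^ i) %% f)`_j].
have [i [j [lt_ij eq_res]]] : exists i j, (i < j)%N /\ res i = res j.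
  apply: boolp.contrapT => no_ij.
  have res_inj : injective (fun i : 'I_(#|T|.+1) => res i).
    move=> i j /= eq_ij; apply/val_inj; case: (ltngtP i j) => // lt_ij.
      by case: no_ij; exists i, j.
    by case: no_ij; exists j, i.
  by have := leq_card _ res_inj; rewrite card_ord ltnn.
have /dvdpP[q eq_q] : f %| 'X^(p ^ i) - 'X^(p ^ j).
  rewrite /dvdp modpD modpN subr_eq0; apply/eqP/polyP => l.
  case: (ltnP l (size f)) => [lt_l | le_l].
    by have := congr1 (fun r : T => r (Ordinal lt_l)) eq_res; rewrite !ffunE.
  by rewrite !nth_default // (leq_trans _ le_l) // ltnW // ltn_modp.
exists (j - i)%N; first by rewrite subn_gt0.
apply: (prime_ideal_exp P_ideal P_prime (m := (p ^ i)%N)).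
have frobN (u : A) : (- u) ^+ (p ^ i) = - u ^+ (p ^ i).
  apply/eqP; rewrite -addr_eq0 -frobeniusD addNr.
  by rewrite expr0n expn_eq0 -leqn0 leqNgt prime_gt0.
rewrite frobeniusD frobN -exprM -expnD subnK 1?ltnW //.
have := congr1 (fun r => (map_poly c r).[s]) eq_q.
rewrite /= rmorphB /= !map_polyXn hornerD hornerN !hornerXn rmorphM /= hornerM => eq_s.
rewrite -opprB; apply: (idealN P_ideal); rewrite eq_s.
exact: (idealMl P_ideal).
Qed.

Lemma frobenius_iter (P : {pred A}) s m n : idealr_closed P ->
  s ^+ (p ^ m) - s \in P -> s ^+ (p ^ (m * n)) - s \in P.
Proof.
move=> P_ideal Ps; elim: n => [|n IHn].
  by rewrite muln0 expn0 expr1 subrr; apply: ideal0.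
rewrite -[X in X \in P](subrKA (s ^+ (p ^ m))) mulnS expnD mulnC exprM.
by apply: (idealD P_ideal) => //; apply: idealX.
Qed.

Lemma frobenius_biv_eval (P : {pred A}) (s t : A) M u : idealr_closed P ->
    s ^+ (p ^ M) - s \in P -> t ^+ (p ^ M) - t \in P ->
  biv_eval c s t u ^+ (p ^ M) - biv_eval c s t u \in P.
Proof.
move=> P_ideal Ps Pt; elim/bivariate_ind: u => [a|||u v IHu IHv|u v IHu IHv].
- rewrite biv_evalC -rmorphXn /= (_ : a ^+ _ = a) ?subrr; first exact: ideal0.
  elim: M {Ps Pt} => [|n IHn]; first by rewrite expr1.
  by rewrite expnSr exprM IHn Fp_frobenius.
- by rewrite biv_evalX.
- by rewrite biv_evalY.
- rewrite biv_evalD frobeniusD opprD addrACA.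
  exact: idealD.
- rewrite biv_evalM exprMn.
  move: (biv_eval c s t u) (biv_eval c s t v) IHu IHv => f g Pf Pg.
  have -> : f ^+ (p ^ M) * g ^+ (p ^ M) - f * g =
    g ^+ (p ^ M) * (f ^+ (p ^ M) - f) + f * (g ^+ (p ^ M) - g) by ring.
  by apply: (idealD P_ideal); apply: (idealMl P_ideal).
Qed.

End FiniteField.

(** * The Hasse relations modulo p *)

Section MpolyDerivation.
Local Open Scope ring_scope.
Variables (R : comNzRingType) (n : nat).

Lemma mpoly_ring_ind (P : {mpoly R[n]} -> Prop) :
    (forall a, P a%:MP) -> (forall i, P 'X_i) ->
    (forall f g, P f -> P g -> P (f + g)) ->
    (forall f g, P f -> P g -> P (f * g)) ->
  forall f, P f.
Proof.
move=> PC PX PD PM; elim/mpolyind => [|a m f _ _ IHf].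
  by rewrite -mpolyC0; apply: PC.
rewrite -mul_mpolyC mpolyXE_id; apply/PD/IHf/PM; first exact: PC.
apply: (big_ind P) => [|f1 f2|i _]; [by rewrite -mpolyC1; apply: PC | exact: PM |].
elim: (m i) => [|e IHe]; first by rewrite expr0 -mpolyC1; apply: PC.
by rewrite exprS; apply/PM/IHe/PX.
Qed.

Lemma mderiv_derivation (i : 'I_n) : derivation (@mderiv n R i).
Proof. by split=> f g; rewrite ?mderivD ?mderivM. Qed.

Lemma mderivU (i j : 'I_n) : ('X_j : {mpoly R[n]})^`M(i) = (i == j)%:R.
Proof.
rewrite mderivX mnm1E eq_sym; case: eqP => [->|_]; last by rewrite scale0r.
have -> : (U_(j) - U_(j) = 0 :> 'X_{1.. n})%MM.
  by apply/mnmP => l; rewrite mnmBE subnn mnm0E.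
by rewrite mpolyX0 scale1r.
Qed.

Lemma mderivCU (i j : 'I_n) (c : R) :
  (c%:MP * 'X_j)^`M(i) = (c * (i == j)%:R)%:MP.
Proof. by rewrite mderiv_mulC mderivU mpolyCM rmorph_nat. Qed.

Lemma mmap_chain (S : comNzRingType) (c : {rmorphism R -> S}) (h : 'I_n -> S)
    (D : S -> S) f : derivation D -> (forall a, D (c a) = 0) ->
  D (mmap c h f) = \sum_(i < n) mmap c h f^`M(i) * D (h i).
Proof.
case=> DD DM Dc; elim/mpoly_ring_ind: f => [a|i|f g IHf IHg|f g IHf IHg].
- by rewrite mmapC Dc big1 // => i _; rewrite mderivC rmorph0 mul0r.
- rewrite mmapX mmap1U (bigD1 i) //= big1 => [|j neq_ji].
    by rewrite mderivU eqxx rmorph1 mul1r addr0.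
  by rewrite mderivU (negPf neq_ji) rmorph0 mul0r.
- rewrite rmorphD /= DD IHf IHg -big_split; apply: eq_bigr => i _.
  by rewrite mderivD rmorphD /= mulrDl.
- rewrite rmorphM /= DM IHf IHg mulr_suml mulr_sumr -big_split.
  by apply: eq_bigr => i _; rewrite mderivM rmorphD !rmorphM /=; ring.
Qed.

End MpolyDerivation.

Lemma Fp_neq0_2 (p : nat) : prime p -> p <> 2 -> (2 != 0 :> 'F_p)%R.
Proof.
move=> p_pr p_neq2; rewrite -(dvdn_pcharf (pchar_Fp p_pr)) dvdn_prime2 //.
exact/eqP.
Qed.

Lemma Fp_neq0_3 (p : nat) : prime p -> p <> 3 -> (3 != 0 :> 'F_p)%R.
Proof.
move=> p_pr p_neq3; rewrite -(dvdn_pcharf (pchar_Fp p_pr)) dvdn_prime2 //.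
exact/eqP.
Qed.

Section ReductionModP.
Local Open Scope ring_scope.
Variable p : nat.
Hypotheses (p_pr : prime p) (p_neq2 : p <> 2%N) (p_neq3 : p <> 3%N).
Local Notation k := 'F_p.
Local Notation A := {mpoly k[3]}.
Local Notation B := {poly {poly k}}.
Local Notation x := ('X%:P : B).
Local Notation y := ('X : B).

Let p_char : p \in [pchar k] := pchar_Fp p_pr.

Let k2 : 2 != 0 :> k := Fp_neq0_2 p_pr p_neq2.
Let k3 : 3 != 0 :> k := Fp_neq0_3 p_pr p_neq3.

Local Notation e2 := (eisK k eis2).
Local Notation e4 := (eisK k eis4).
Local Notation e6 := (eisK k eis6).
Local Notation ev := (biv_eval (@fps_const k) e4 e6).

Definition theta12 (u : fps k) : fps k := 12 * theta u.

Lemma theta12_derivation : derivation theta12.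
Proof.
split=> u v; first by rewrite /theta12 raddfD mulrDr.
by rewrite /theta12 thetaM; ring.
Qed.

Lemma theta12_const a : theta12 (fps_const a) = 0.
Proof. by rewrite /theta12 theta_const mulr0. Qed.

Lemma theta12_e4 : theta12 e4 = 4 * (e2 * e4 - e6).
Proof. by rewrite -theta_eisK4 /theta12; ring. Qed.

Lemma theta12_e6 : theta12 e6 = 6 * (e2 * e6 - e4 ^+ 2).
Proof. by rewrite -theta_eisK6 /theta12; ring. Qed.

Lemma iter_theta12 u : iter p theta12 u = theta12 u.
Proof.
have iterE m n : iter m theta12 u n = (12 * n%:R) ^+ m * u n.
  elim: m => [|m IHm]; first by rewrite mul1r.
  by rewrite iterS /theta12 (fps_natM 12) /theta IHm exprS !mulrA.
apply: fpsP => n; rewrite iterE Fp_frobenius // /theta12 (fps_natM 12) /theta.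
by rewrite mulrA.
Qed.

(** The two sides are the p-th and the first derivative of g, which agree since
    n ^ p = n modulo p. *)
Lemma serre_iter_frobenius K (g : B) : weight g = K.+1%:R * g ->
  ev (serre_iter K g p) = ev (serre g) + e2 * ev (weight g).
Proof.
move=> weight_g.
have [D_der Dc] := (theta12_derivation, theta12_const).
rewrite -(derive_eval D_der Dc theta12_e4 theta12_e6) -iter_theta12.
by rewrite (iter_prime_derive_eval weight_g D_der Dc theta12_e4 theta12_e6
  (theta_eisK2 k) p_char).
Qed.

(** On the cuspidal curve the iterated Serre derivative is a product of p
    consecutive integers times a monomial. *)
Lemma disc_dvd_serre_iter K (g : B) :
    weight g = K.+1%:R * g ->
    biv_eval (@polyC k) 'X^4 'X^6 g = 'X^(K.+1) ->
  exists2 h, serre_iter K g p = (x ^+ 3 - y ^+ 2) * h &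
    weight h + 12 * h = K.+1%:R * h.
Proof.
move=> weight_g cusp_g.
have [|h eq_h] := @cusp_eq0_dvd _ (serre_iter K g p).
  rewrite cusp_serre_iter // -bin_ffact natrM.
  have -> : p`!%:R = 0 :> {poly k}.
    rewrite -(rmorph_nat (@polyC k)); apply/eqP; rewrite polyC_eq0.
    by rewrite -(dvdn_pcharf p_char) dvdn_fact // prime_gt0 /=.
  by rewrite !(mulr0, mul0r).
exists h => //; have wD := @weight_derivation k.
have disc_neq0 : x ^+ 3 - y ^+ 2 != 0.
  apply/eqP => /(congr1 (fun u : B => u`_2)) /eqP.
  by rewrite coefB coefXn -polyC_exp coefC /= coef0 sub0r oppr_eq0 oner_eq0.
apply: (mulfI disc_neq0).
have weight_disc : weight (x ^+ 3 - y ^+ 2) = 12 * (x ^+ 3 - y ^+ 2).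
  by rewrite (derivationB _ _ wD) !(derivationX _ _ wD) weightX weightY; ring.
have p0 : p.*2%:R = 0 :> B.
  rewrite -(rmorph_nat (@polyC {poly k})) -(rmorph_nat (@polyC k)).
  by rewrite -muln2 natrM (pcharf0 p_char) mul0r !rmorph0.
have := weight_serre_iter weight_g p; rewrite eq_h wD.2 weight_disc natrD p0 addr0.
by move=> eq_w; rewrite [RHS]mulrCA -eq_w; ring.
Qed.

(** The equations of [serre_iter_frobenius] for E_4 and E_6 form a linear system
    for alpha and beta whose determinant is a multiple of E_4 ^ 3 - E_6 ^ 2, by
    which the right-hand sides are divisible. The solutions found in this way are
    the reductions of E_(p-1) ^ 2 and E_(p-1) E_(p+1). *)
Lemma exists_hasse : exists alpha beta : B,
  [/\ weight alpha = - 2 * alpha, ev alpha = 1 & ev beta = e2].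
Proof.
have wX : weight x = 4 * x := weightX k.
have wY : weight y = 6 * y := weightY k.
have [|a4 a4E wa4] := disc_dvd_serre_iter wX; first by rewrite biv_evalX.
have [|a6 a6E wa6] := disc_dvd_serre_iter wY; first by rewrite biv_evalY.
have := serre_iter_frobenius wX; have := serre_iter_frobenius wY.
rewrite a4E a6E wX wY serreX serreY.
rewrite !biv_evalN !biv_evalM !biv_evalB !biv_eval_exp !biv_eval_nat.
rewrite biv_evalX biv_evalY => ev6 ev4.
pose c24 : B := (24^-1)%:P%:P.
have c24E : 24 * c24 = 1.
  rewrite /c24 -(rmorph_nat (@polyC {poly k})) -(rmorph_nat (@polyC k)).
  rewrite -!polyCM divff //.
  by rewrite (_ : 24 = 2 * 2 * 2 * 3) ?mulf_neq0 //; ring.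
have disc_neq0 : e4 ^+ 3 - e6 ^+ 2 <> 0.
  have [e40 e41 e60 e61] := eisK_coef k.
  move=> /(congr1 (fun u : fps k => u 1%N)) /eqP; apply/negP.
  rewrite fpsDE fpsNE !exprS expr0 !mulr1 !fpsM_coef1 !fpsM_coef0 e40 e41 e60 e61.
  rewrite fps0E (_ : _ - _ = 2 ^+ 6 * 3 ^+ 3); last by ring.
  by rewrite mulf_neq0 // expf_neq0.
exists (c24 * (6 * (y * a4) - 4 * (x * a6))).
exists (c24 * (6 * (x ^+ 2 * a4) - 4 * (y * a6))).
have ev_c24 : 24 * ev c24 = 1.
  have := congr1 ev c24E; rewrite biv_evalM biv_eval_nat => ->; exact: rmorph1.
split.
- have wD := @weight_derivation k.
  rewrite wD.2 weightC mul0r add0r (derivationB _ _ wD).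
  rewrite !(derivation_nat _ _ wD) !wD.2 wX wY.
  have -> : weight a4 = 4 * a4 - 12 * a4 by rewrite -wa4 addrK.
  have -> : weight a6 = 6 * a6 - 12 * a6 by rewrite -wa6 addrK.
  by ring.
- apply: (fps_mulfI disc_neq0).
  rewrite !(biv_evalM, biv_evalB, biv_eval_nat, biv_evalX, biv_evalY).
  move: ev4 ev6 ev_c24; move: (ev a4) (ev a6) (ev c24) => F4 F6 c.
  move: e2 e4 e6 => f2 f4 f6 ev4 ev6 ev_c.
  transitivity (c * (6 * f6 * ((f4 ^+ 3 - f6 ^+ 2) * F4)
                     - 4 * f4 * ((f4 ^+ 3 - f6 ^+ 2) * F6))); first by ring.
  rewrite ev4 ev6; transitivity (24 * c * (f4 ^+ 3 - f6 ^+ 2)); first by ring.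
  by rewrite ev_c mul1r mulr1.
- apply: (fps_mulfI disc_neq0).
  rewrite !(biv_evalM, biv_evalB, biv_eval_nat, biv_eval_exp, biv_evalX, biv_evalY).
  move: ev4 ev6 ev_c24; move: (ev a4) (ev a6) (ev c24) => F4 F6 c.
  move: e2 e4 e6 => f2 f4 f6 ev4 ev6 ev_c.
  transitivity (c * (6 * f4 ^+ 2 * ((f4 ^+ 3 - f6 ^+ 2) * F4)
                     - 4 * f6 * ((f4 ^+ 3 - f6 ^+ 2) * F6))); first by ring.
  rewrite ev4 ev6; transitivity (24 * c * (f4 ^+ 3 - f6 ^+ 2) * f2); first by ring.
  by rewrite ev_c mul1r.
Qed.

End ReductionModP.

(** * The ideal of the q-expansion modulo p *)

Section Curve.
Local Open Scope ring_scope.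
Variable p : nat.
Hypotheses (p_pr : prime p) (p_neq2 : p <> 2%N) (p_neq3 : p <> 3%N).
Local Notation k := 'F_p.
Local Notation A := {mpoly k[3]}.
Local Notation B := {poly {poly k}}.
Local Notation o0 := (@Ordinal 3 0 isT).
Local Notation o1 := (@Ordinal 3 1 isT).
Local Notation o2 := (@Ordinal 3 2 isT).

Let k2 : 2 != 0 :> k := Fp_neq0_2 p_pr p_neq2.
Let k3 : 3 != 0 :> k := Fp_neq0_3 p_pr p_neq3.
Lemma big_ord3 (V : nmodType) (F : 'I_3 -> V) :
  \sum_(i < 3) F i = F o0 + F o1 + F o2.
Proof.
rewrite !big_ord_recl big_ord0 addr0 addrA.
by congr (_ + _ + _); congr F; apply: val_inj.
Qed.

Lemma ord3_ind (P : 'I_3 -> Prop) : P o0 -> P o1 -> P o2 -> forall i, P i.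
Proof.
move=> P0 P1 P2 [[|[|[|//]]] lt_i3].
- by rewrite (_ : Ordinal _ = o0) //; apply: val_inj.
- by rewrite (_ : Ordinal _ = o1) //; apply: val_inj.
- by rewrite (_ : Ordinal _ = o2) //; apply: val_inj.
Qed.

Definition base_point : 'rV[k]_3 := row3 (- 12^-1) 12^-1 (- 216^-1).
Definition base_tangent : 'rV[k]_3 := row3 2 20 (7 / 3).
Local Notation a := base_point.
Local Notation b := base_tangent.

Definition ram (i : 'I_3) : fps k := [:: ram1 k; ram2 k; ram3 k]`_i.

Lemma ram_base_point i : ram i 0%N = a 0 i.
Proof.
have [t10 t20 t30] := ram_coef0 k.
by rewrite /base_point /row3 mxE; elim/ord3_ind: i.
Qed.

Lemma ram_base_tangent i : ram i 1%N = b 0 i.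
Proof.
have [t11 t21 t31] := ram_coef1 k2 k3.
by rewrite /base_tangent /row3 mxE; elim/ord3_ind: i.
Qed.

Definition qexp : A -> fps k := mmap (@fps_const k) ram.
HB.instance Definition _ := GRing.RMorphism.copy qexp (mmap (@fps_const k) ram).

Lemma qexpC c : qexp c%:MP = fps_const c.
Proof. exact: mmapC. Qed.

Lemma qexpX i : qexp 'X_i = ram i.
Proof. by rewrite /qexp mmapX mmap1U. Qed.

Lemma qexpD f g : qexp (f + g) = qexp f + qexp g. Proof. exact: rmorphD. Qed.
Lemma qexpB f g : qexp (f - g) = qexp f - qexp g. Proof. exact: rmorphB. Qed.
Lemma qexpM f g : qexp (f * g) = qexp f * qexp g. Proof. exact: rmorphM. Qed.
Lemma qexp1 : qexp 1 = 1. Proof. exact: rmorph1. Qed.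
Lemma qexp0 : qexp 0 = 0. Proof. exact: rmorph0. Qed.

Lemma qexpZ c f : qexp (c *: f) = fps_const c * qexp f.
Proof. by rewrite -mul_mpolyC qexpM qexpC. Qed.

Lemma qexp_coef0 f : qexp f 0%N = f.@[fun i => a 0 i].
Proof.
elim/mpoly_ring_ind: f => [c|i|f g IHf IHg|f g IHf IHg].
- by rewrite qexpC mevalC.
- by rewrite qexpX mevalXU ram_base_point.
- by rewrite qexpD fpsDE IHf IHg mevalD.
- by rewrite qexpM fpsM_coef0 IHf IHg mevalM.
Qed.

Lemma theta_derivation : derivation (@theta k).
Proof. by split=> u v; [apply: raddfD | apply: thetaM]. Qed.

Lemma theta_qexp f :
  theta (qexp f) = \sum_(i < 3) qexp f^`M(i) * theta (ram i).
Proof. exact: (mmap_chain _ _ theta_derivation (@theta_const k)). Qed.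

Lemma qexp_coef1 f :
  qexp f 1%N = \sum_(i < 3) b 0 i * (f^`M(i)).@[fun j => a 0 j].
Proof.
have theta1E (u : fps k) : theta u 1%N = u 1%N by rewrite /theta mul1r.
have mul_theta1 (u v : fps k) : (u * theta v) 1%N = v 1%N * u 0%N.
  by rewrite fpsM_coef1 theta1E /theta mul0r mulr0 addr0 mulrC.
have add3_1 (u v w : fps k) : (u + v + w) 1%N = u 1%N + v 1%N + w 1%N by [].
rewrite -[LHS](theta1E (qexp f)) theta_qexp 2!big_ord3 add3_1.
by congr (_ + _ + _); apply: (etrans (mul_theta1 _ _));
  rewrite ram_base_tangent qexp_coef0.
Qed.

(** The ideal of the Zariski closure of the formal solution curve. *)
Definition curve_pred : {pred A} := [pred f | qexp f == 0].
Local Notation I := curve_pred.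

Lemma in_curve f : reflect (qexp f = 0) (f \in I).
Proof. exact: eqP. Qed.

Lemma curve_prime : prime_ideal I.
Proof.
split; first split.
- by apply/in_curve; apply: qexp0.
- by apply/in_curve => /eqP; rewrite qexp1 oner_eq0.
- move=> f u v /in_curve u0 /in_curve v0; apply/in_curve.
  by rewrite qexpD qexpM u0 v0 mulr0 addr0.
- move=> u v /in_curve; rewrite qexpM => /fps_mul_eq0[] /in_curve -> //.
  exact: orbT.
Qed.

Lemma qexp_ramanujan_coef i :
  qexp (ramanujan_coef k i) = - theta (ram i).
Proof.
have [eq1 eq2 eq3] := ramanujan_system k2 k3.
elim/ord3_ind: i; rewrite /ramanujan_coef /=.
- rewrite qexpB qexpZ expr2 qexpM !qexpX.
  by rewrite -[ram o0]/(ram1 k) -[ram o1]/(ram2 k) eq1 expr2.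
- rewrite qexpB !qexpZ qexpM !qexpX.
  rewrite -[ram o0]/(ram1 k) -[ram o1]/(ram2 k) -[ram o2]/(ram3 k) eq2.
  by rewrite -(rmorph_nat (@fps_const k)) -(rmorph_nat (@fps_const k) 6).
- rewrite qexpB !qexpZ expr2 !qexpM !qexpX.
  rewrite -[ram o0]/(ram1 k) -[ram o1]/(ram2 k) -[ram o2]/(ram3 k) eq3 expr2.
  by rewrite -(rmorph_nat (@fps_const k)).
Qed.

Lemma qexp_ramanujan f : qexp (ramanujan_vf f) = - theta (qexp f).
Proof.
rewrite /ramanujan_vf /derivation_of theta_qexp -sumrN.
rewrite (raddf_sum qexp); apply: eq_bigr => i _.
by rewrite [LHS]qexpM qexp_ramanujan_coef mulNr mulrC.
Qed.

Lemma qexp_iter_ramanujan m f n :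
  qexp (iter m (@ramanujan_vf k) f) n = (- n%:R) ^+ m * qexp f n.
Proof.
elim: m => [|m IHm]; first by rewrite mul1r.
by rewrite iterS qexp_ramanujan fpsNE /theta IHm exprS !mulNr mulrA.
Qed.

Lemma curve_tangent : tangent_to (@ramanujan_vf k) I.
Proof.
move=> f /in_curve f0; apply/in_curve.
by rewrite qexp_ramanujan f0 raddf0 oppr0.
Qed.

(** On q-expansions the p-th power of the field multiplies the coefficient of
    q ^ n by (- n) ^ p = - n. *)
Lemma curve_p_closed :
  derivations_agree_on (iter p (@ramanujan_vf k)) (@ramanujan_vf k) I.
Proof.
move=> g; apply/in_curve; rewrite qexpB; apply: fpsP => n.
rewrite fpsDE fpsNE qexp_iter_ramanujan qexp_ramanujan fpsNE /theta.
by rewrite Fp_frobenius // mulNr subrr.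
Qed.

Lemma curve_passes : passes_through I a.
Proof. by move=> f /in_curve f0; rewrite -qexp_coef0 f0. Qed.

Lemma curve_tangent_vector : tangent_vector I a b.
Proof. by move=> f /in_curve f0; rewrite -qexp_coef1 f0. Qed.

End Curve.

(** * Smoothness at the base point *)

Section TangentLine.
Local Open Scope ring_scope.

(** The tangent space at the base point is cut out by two linear forms: one
    in (w1, w2), whose value on the Euler direction is - 2, and one that
    involves w0. The scalar is found from 9 * (7 / 3) - 20 = 1. *)
Lemma tangent_line_eq (K : fieldType) (ax ay bx b_y w0 w1 w2 : K) :
    2 != 0 :> K -> 3 != 0 :> K -> 4 * ax + 6 * ay = - 2 ->
    12 * 20 * ax - 216 * (7 / 3) * ay = 0 ->
    12 * 20 * bx - 216 * (7 / 3) * b_y + 12 * 2 = 0 ->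
    12 * w1 * ax - 216 * w2 * ay = 0 ->
    12 * w1 * bx - 216 * w2 * b_y + 12 * w0 = 0 ->
  let c := 9 * w2 - w1 in [/\ w0 = c * 2, w1 = c * 20 & w2 = c * (7 / 3)].
Proof.
move=> K2 K3 euler alpha_b beta_b alpha_w beta_w c.
have K12 : 12 != 0 :> K by rewrite (_ : 12 = 2 * 2 * 3) ?mulf_neq0 //; ring.
pose r := w2 - c * (7 / 3).
have w2E : w2 = c * (7 / 3) + r by rewrite addrC subrK.
have w1E : w1 = c * 20 + 9 * r by rewrite /r /c; field.
have r0 : r = 0.
  apply: (@mulfI _ (- 2)); first by rewrite oppr_eq0.
  rewrite mulr0 -euler.
  transitivity (4 / 3 * ((12 * w1 * ax - 216 * w2 * ay)
                         - c * (12 * 20 * ax - 216 * (7 / 3) * ay))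
                - 7 / 12 * r * (12 * 20 * ax - 216 * (7 / 3) * ay)).
    by rewrite {1}w1E {1}w2E; field; rewrite K3 K12.
  by rewrite alpha_w alpha_b !mulr0 !subr0 mulr0.
have w2c : w2 = c * (7 / 3) by rewrite w2E r0 addr0.
have w1c : w1 = c * 20 by rewrite w1E r0 mulr0 addr0.
split=> //; apply: (mulfI K12); apply/eqP; rewrite -subr_eq0; apply/eqP.
transitivity ((12 * w1 * bx - 216 * w2 * b_y + 12 * w0)
              - c * (12 * 20 * bx - 216 * (7 / 3) * b_y + 12 * 2)).
  by rewrite {1}w1c {1}w2c; field.
by rewrite beta_w beta_b mulr0 subrr.
Qed.

End TangentLine.

Section SmoothCurve.
Local Open Scope ring_scope.
Variable p : nat.
Hypotheses (p_pr : prime p) (p_neq2 : p <> 2%N) (p_neq3 : p <> 3%N).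
Local Notation k := 'F_p.
Local Notation A := {mpoly k[3]}.
Local Notation B := {poly {poly k}}.
Local Notation o0 := (@Ordinal 3 0 isT).
Local Notation o1 := (@Ordinal 3 1 isT).
Local Notation o2 := (@Ordinal 3 2 isT).
Local Notation a := (base_point p).
Local Notation b := (base_tangent p).
Local Notation I := (@curve_pred p).
Local Notation ev := (biv_eval (@fps_const k) (eisK k eis4) (eisK k eis6)).

Let k2 : 2 != 0 :> k := Fp_neq0_2 p_pr p_neq2.
Let k3 : 3 != 0 :> k := Fp_neq0_3 p_pr p_neq3.
Let k12 : 12 != 0 :> k.
Proof. by rewrite (_ : 12 = 2 * 2 * 3) ?mulf_neq0 //; ring. Qed.
Let k216 : 216 != 0 :> k.
Proof. by rewrite (_ : 216 = 2 * 2 * 2 * 3 * 3 * 3) ?mulf_neq0 //; ring. Qed.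

(** The functions E_2, E_4, E_6 in the coordinates t_1, t_2, t_3. *)
Definition coord2 : A := (- 12)%:MP * 'X_o0.
Definition coord4 : A := 12%:MP * 'X_o1.
Definition coord6 : A := (- 216)%:MP * 'X_o2.
Local Notation psi := (biv_eval (@mpolyC 3 k) coord4 coord6).

Let constK (c d : k) (u : fps k) :
  c * d = 1 -> fps_const c * (fps_const d * u) = u.
Proof. by move=> cd1; rewrite mulrA -rmorphM cd1 rmorph1 mul1r. Qed.

Lemma qexp_coord2 : qexp coord2 = eisK k eis2.
Proof. by rewrite qexpM qexpC qexpX constK // mulrNN divff. Qed.

Lemma qexp_coord4 : qexp coord4 = eisK k eis4.
Proof. by rewrite qexpM qexpC qexpX constK // divff. Qed.

Lemma qexp_coord6 : qexp coord6 = eisK k eis6.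
Proof. by rewrite qexpM qexpC qexpX constK // mulrNN divff. Qed.

Lemma qexp_psi u : qexp (psi u) = ev u.
Proof.
elim/bivariate_ind: u => [c|||u v IHu IHv|u v IHu IHv].
- by rewrite !biv_evalC qexpC.
- by rewrite !biv_evalX qexp_coord4.
- by rewrite !biv_evalY qexp_coord6.
- by rewrite !biv_evalD qexpD IHu IHv.
- by rewrite !biv_evalM qexpM IHu IHv.
Qed.

Lemma coord4_base_point : coord4.@[fun j => a 0 j] = 1.
Proof. by rewrite /coord4 mevalM mevalC mevalXU !mxE /= divff. Qed.

Lemma coord6_base_point : coord6.@[fun j => a 0 j] = 1.
Proof. by rewrite /coord6 mevalM mevalC mevalXU !mxE /= mulrNN divff. Qed.

Lemma mderiv_coord2 i : (coord2)^`M(i) = (- 12 * (i == o0)%:R)%:MP.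
Proof. exact: mderivCU. Qed.

Lemma mderiv_coord4 i : (coord4)^`M(i) = (12 * (i == o1)%:R)%:MP.
Proof. exact: mderivCU. Qed.

Lemma mderiv_coord6 i : (coord6)^`M(i) = (- 216 * (i == o2)%:R)%:MP.
Proof. exact: mderivCU. Qed.

Opaque coord2 coord4 coord6.

Local Notation at1 := (biv_eval idfun (1 : k) 1).

Lemma psi_base_point u : (psi u).@[fun j => a 0 j] = at1 u.
Proof.
rewrite (rmorph_biv_eval (c' := idfun) _ _ _ (mevalC (fun j => a 0 j))) /=.
by rewrite coord4_base_point coord6_base_point.
Qed.

Lemma ev_coef0 u : ev u 0%N = at1 u.
Proof. by rewrite -qexp_psi qexp_coef0 psi_base_point. Qed.

Lemma psi_tangent (w : 'rV[k]_3) u :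
  \sum_(i < 3) w 0 i * ((psi u)^`M(i)).@[fun j => a 0 j] =
  12 * w 0 o1 * at1 (dx u) - 216 * w 0 o2 * at1 (dy u).
Proof.
have chain i : ((psi u)^`M(i)).@[fun j => a 0 j] =
    at1 (dx u) * (12 * (i == o1)%:R) + at1 (dy u) * (- 216 * (i == o2)%:R).
  rewrite (biv_eval_chain _ _ _ (mderiv_derivation k i) (mderivC i)).
  rewrite mderiv_coord4 mderiv_coord6 mevalD !mevalM !mevalC.
  by rewrite (psi_base_point (dx u)) (psi_base_point (dy u)).
by rewrite big_ord3 !chain /=; ring.
Qed.

Lemma coord2_tangent (w : 'rV[k]_3) :
  \sum_(i < 3) w 0 i * (coord2^`M(i)).@[fun j => a 0 j] = - (12 * w 0 o0).
Proof.
rewrite big_ord3 !mderiv_coord2 !mevalC /=; ring.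
Qed.

Lemma curve_smooth : curve_smooth_at I a.
Proof.
have [alpha [beta [w_alpha ev_alpha ev_beta]]] := exists_hasse p_pr p_neq2 p_neq3.
have tb := curve_tangent_vector p_pr p_neq2 p_neq3.
have I_alpha : psi alpha - 1 \in I.
  by apply/in_curve; rewrite qexpB qexp_psi ev_alpha qexp1 subrr.
have I_beta : psi beta - coord2 \in I.
  by apply/in_curve; rewrite qexpB qexp_psi ev_beta qexp_coord2 subrr.
have tangent_alpha w : tangent_vector I a w ->
    12 * w 0 o1 * at1 (dx alpha) - 216 * w 0 o2 * at1 (dy alpha) = 0.
  move=> /(_ _ I_alpha) <-; rewrite -psi_tangent; apply: eq_bigr => i _.
  by rewrite mderivB -mpolyC1 mderivC subr0.
have tangent_beta w : tangent_vector I a w ->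
    12 * w 0 o1 * at1 (dx beta) - 216 * w 0 o2 * at1 (dy beta) + 12 * w 0 o0 = 0.
  move=> /(_ _ I_beta); under eq_bigr do rewrite mderivB mevalB mulrBr.
  rewrite sumrB => <-; apply: esym; apply: etrans
    (congr2 (fun s t => s - t) (psi_tangent w beta) (coord2_tangent w)) _.
  by congr (_ + _); apply: opprK.
have euler : 4 * at1 (dx alpha) + 6 * at1 (dy alpha) = - 2.
  have := congr1 at1 w_alpha; rewrite /weight.
  rewrite biv_evalD !biv_evalM !biv_evalN !biv_eval_nat biv_evalX biv_evalY !mulr1.
  by rewrite -(ev_coef0 alpha) ev_alpha => ->; rewrite fps1E mulr1.
have b0 : b 0 o0 = 2 by rewrite mxE.
have b1 : b 0 o1 = 20 by rewrite mxE.
have b2 : b 0 o2 = 7 / 3 by rewrite mxE.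
exists <[b]>%VS => [w|]; last first.
  rewrite dim_vline (_ : b != 0) //; apply/eqP => /rowP/(_ o0).
  by rewrite b0 mxE => /eqP; apply/negP.
split=> [/vlineP[c ->] f If | tw].
  transitivity (c * (\sum_(i < 3) b 0 i * (f^`M(i)).@[fun j => a 0 j])).
    by rewrite mulr_sumr; apply: eq_bigr => i _; rewrite mxE mulrA.
  by rewrite (tb f If) mulr0.
apply/vlineP; exists (9 * w 0 o2 - w 0 o1).
have := tangent_beta w tw; have := tangent_alpha w tw.
have := tangent_beta b tb; have := tangent_alpha b tb; rewrite b0 b1 b2.
move=> alpha_b beta_b alpha_w beta_w.
have [w0 w1 w2] := tangent_line_eq k2 k3 euler alpha_b beta_b alpha_w beta_w.
by apply/rowP; elim/ord3_ind; rewrite [in RHS]mxE ?b0 ?b1 ?b2.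
Qed.

End SmoothCurve.

(** * Dimension *)

Section CurveDimension.
Local Open Scope ring_scope.
Variable p : nat.
Hypotheses (p_pr : prime p) (p_neq2 : p <> 2%N) (p_neq3 : p <> 3%N).
Local Notation k := 'F_p.
Local Notation A := {mpoly k[3]}.
Local Notation B := {poly {poly k}}.
Local Notation o0 := (@Ordinal 3 0 isT).
Local Notation o1 := (@Ordinal 3 1 isT).
Local Notation o2 := (@Ordinal 3 2 isT).
Local Notation a := (base_point p).
Local Notation I := (@curve_pred p).
Local Notation ev := (biv_eval (@fps_const k) (eisK k eis4) (eisK k eis6)).
Local Notation psi := (biv_eval (@mpolyC 3 k) (coord4 p) (coord6 p)).

Lemma qexp_sub_psi f : exists u, f - psi u \in I.
Proof.
have [alpha [beta [_ _ ev_beta]]] := exists_hasse p_pr p_neq2 p_neq3.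
suff [u fu] : exists u, qexp f = ev u.
  by exists u; apply/in_curve; rewrite qexpB qexp_psi // fu subrr.
elim/mpoly_ring_ind: f => [c|i|f g [u fu] [v gv]|f g [u fu] [v gv]].
- by exists c%:P%:P; rewrite biv_evalC qexpC.
- elim/ord3_ind: i; rewrite qexpX.
  + by exists ((- 12^-1)%:P%:P * beta); rewrite biv_evalM biv_evalC ev_beta.
  + by exists ((12^-1)%:P%:P * 'X%:P); rewrite biv_evalM biv_evalC biv_evalX.
  + by exists ((- 216^-1)%:P%:P * 'X); rewrite biv_evalM biv_evalC biv_evalY.
- by exists (u + v); rewrite biv_evalD qexpD fu gv.
- by exists (u * v); rewrite biv_evalM qexpM fu gv.
Qed.

(** Modulo a prime that strictly contains the ideal of the curve the functions
    E_4 and E_6 become algebraic over the prime field, so that some power of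
    Frobenius is the identity. *)
Lemma curve_prime_maximal (P Q : {pred A}) (g : A) :
    prime_ideal P -> prime_ideal Q -> {subset I <= P} -> {subset P <= Q} ->
    g \in P -> g \notin I ->
  {subset Q <= P}.
Proof.
move=> P_prime Q_prime sIP sPQ Pg nIg.
have I_prime := curve_prime p.
have [[I_ideal _] [P_ideal P_primeM]] := (I_prime, P_prime).
have [alpha [beta [w_alpha ev_alpha _]]] := exists_hasse p_pr p_neq2 p_neq3.
have F_neq0 : alpha - 1 != 0.
  apply/eqP => /subr0_eq alpha1; move: w_alpha; rewrite alpha1 mulr1.
  rewrite -[X in weight X](polyC1 {poly k}) -polyC1 weightC => /eqP.
  rewrite eq_sym oppr_eq0 -(rmorph_nat (@polyC {poly k})) -(rmorph_nat (@polyC k)).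
  by rewrite !polyC_eq0; apply/negP/Fp_neq0_2.
have I_F : psi (alpha - 1) \in I.
  by apply/in_curve; rewrite qexp_psi // biv_evalB ev_alpha rmorph1 subrr.
have [G IgG] := qexp_sub_psi g.
have PG : psi G \in P by rewrite -(idealBE P_ideal (sIP _ IgG)).
have nIG : psi G \notin I by rewrite -(idealBE I_ideal IgG).
have [f4 f4_neq0 Pf4] := prime_elimination I_prime P_prime sIP F_neq0 I_F PG nIG.
have swapF_neq0 : swapXY (alpha - 1) != 0 by rewrite swapXY_eq0.
(* The same elimination with the roles of E_4 and E_6 exchanged. *)
rewrite -biv_eval_swap in I_F; rewrite -biv_eval_swap in PG.
rewrite -biv_eval_swap in nIG.
have [f6 f6_neq0 Pf6] := prime_elimination I_prime P_prime sIP swapF_neq0 I_F PG nIG.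
rewrite biv_eval_polyC in Pf4; rewrite biv_eval_polyC in Pf6.
have [m4 m4_gt0 Pm4] := frobenius_periodic p_pr P_prime f4_neq0 Pf4.
have [m6 m6_gt0 Pm6] := frobenius_periodic p_pr P_prime f6_neq0 Pf6.
pose q := (p ^ (m4 * m6))%N.
have Pq4 : coord4 p ^+ q - coord4 p \in P by apply: frobenius_iter.
have Pq6 : coord6 p ^+ q - coord6 p \in P.
  by rewrite /q mulnC; apply: frobenius_iter.
have Pq h : h ^+ q - h \in P.
  have [u Ihu] := qexp_sub_psi h.
  have Phu := sIP _ Ihu.
  have P_psi := frobenius_biv_eval (@mpolyC 3 k) p_pr u P_ideal Pq4 Pq6.
  have -> : h ^+ q - h = (h ^+ q - psi u ^+ q) + (psi u ^+ q - psi u) - (h - psi u).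
    by ring.
  apply: (idealB P_ideal) => //; apply: (idealD P_ideal) => //.
  exact: idealX.
have [Q_ideal _] := Q_prime.
move=> h Qh; apply: contraT => nPh.
have q_gt1 : (1 < q)%N.
  rewrite (leq_trans (prime_gt1 p_pr)) // -{1}[p]expn1.
  by rewrite leq_pexp2l ?muln_gt0 ?m4_gt0 ?m6_gt0 ?prime_gt0.
have := Pq h; have -> : h ^+ q - h = h * (h ^+ q.-1 - 1).
  by rewrite -{1}(ltn_predK q_gt1) exprS mulrBr mulr1.
case/P_primeM/orP; first by rewrite (negPf nPh).
have Qh_exp m : (0 < m)%N -> h ^+ m \in Q.
  by case: m => // m _; rewrite exprSr; apply: (idealMl Q_ideal).
move/sPQ/(idealBE Q_ideal); rewrite Qh_exp ?(negPf (ideal1 Q_ideal)) //.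
by rewrite -ltnS (ltn_predK q_gt1).
Qed.

End CurveDimension.

Section CurveIdeal.
Local Open Scope ring_scope.
Variable p : nat.
Hypotheses (p_pr : prime p) (p_neq2 : p <> 2%N) (p_neq3 : p <> 3%N).
Local Notation k := 'F_p.
Local Notation A := {mpoly k[3]}.
Local Notation o0 := (@Ordinal 3 0 isT).
Local Notation a := (base_point p).
Local Notation I := (@curve_pred p).

Definition point_pred : {pred A} := [pred f | f.@[fun j => a 0 j] == 0].

Lemma point_prime : prime_ideal point_pred.
Proof.
split; first split.
- by rewrite inE meval0.
- by rewrite inE meval1 oner_eq0.
- move=> f u v; rewrite !inE => /eqP u0 /eqP v0.
  by rewrite mevalD mevalM u0 v0 mulr0 addr0.
- by move=> u v; rewrite !inE mevalM mulf_eq0.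
Qed.

Lemma curve_sub_point : {subset I <= point_pred}.
Proof. by move=> f If; rewrite inE (curve_passes If). Qed.

Lemma point_not_sub_curve : ~ {subset point_pred <= I}.
Proof.
move=> /(_ ('X_o0 - (a 0 o0)%:MP)); rewrite inE mevalB mevalXU mevalC subrr.
move=> /(_ (eqxx 0))/in_curve/(congr1 (fun u : fps k => u 1%N)) /eqP.
rewrite qexpB qexpX qexpC fpsDE fpsNE subr0 ram_base_tangent //.
by rewrite mxE /=; apply/negP; apply: Fp_neq0_2.
Qed.

Lemma curve_curve_ideal : curve_ideal I.
Proof.
have [I_ideal I_primeM] := curve_prime p.
split=> [|P [P_prime sIP P_min]].
  split; first exact: I_ideal.
  by move=> f n; apply: (prime_ideal_exp I_ideal I_primeM).
have sPI : {subset P <= I} by apply: (P_min I (curve_prime p)).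
split; last first.
  case=> c [c_prime sPc c_strict].
  have [s01 ns10] := c_strict 0%N isT; have [s12 ns21] := c_strict 1%N isT.
  have [g c1g nc0g] : exists2 g, g \in c 1%N & g \notin c 0%N.
    apply: boolp.contrapT => no_g; apply: ns10 => g c1g.
    by apply: contraT => nc0g; case: no_g; exists g.
  have sIc1 : {subset I <= c 1%N} by move=> f If; apply/s01/sPc/sIP.
  apply: ns21.
  apply: (curve_prime_maximal p_pr p_neq2 p_neq3 (c_prime 1%N isT)
            (c_prime 2%N isT) sIc1 s12 c1g).
  by apply: contra nc0g => /sIP/sPc.
exists (fun i => if i == 0%N then P else point_pred); split=> //.
  by case=> // i _; apply: point_prime.
case=> // _; split=> /= [f /sPI | s_point]; first exact: curve_sub_point.
by apply: point_not_sub_curve => f /s_point /sPI.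
Qed.

Lemma curve_condition_holds : curve_condition p.
Proof.
exists I; split.
- exact: curve_curve_ideal.
- by split; [apply: curve_passes | apply: curve_smooth].
- exact: curve_tangent_vector.
- exact: curve_tangent.
- exact: curve_p_closed.
Qed.

End CurveIdeal.

Theorem theorem4p3 (p : nat) (p_prime : prime p) (p_neq2 : p <> 2)
    (p_neq3 : p <> 3) :
  curve_condition p <-> integrality_condition p.
Proof.
split=> _; first exact: integrality_holds.
exact: curve_condition_holds.
Qed.
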